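(* Let $\hat\xi^{(1)},\dots,\hat\xi^{(N)}$ be i.i.d. samples of $\mathbb P^\star$, of which the agents have access to the observations $h_i(\hat\xi^{(k)})$, $i\in\{1,\dots,n\}$, $k\in\{1,\dots,N\}$. Suppose that the stacked observation function $h:\mathbb R^m\to\mathbb R^m$ is invertible and measurable, and that $h$ is inferable with inflation $C$. Fix $\theta\in(0,1)$. Then $$\Pr\{\mathbb P^\star\in\mathcal B_{[C+1]\epsilon}(\hat{\mathbb P}_h^N)\}\ge 1-\theta,$$ where $$\epsilon=\begin{cases}\left(\dfrac{\log(c_1\theta^{-1})}{c_2N}\right)^{1/\max\{m,2\}}, & N\ge \dfrac{\log(c_1\theta^{-1})}{c_2},\\[2mm] \left(\dfrac{\log(c_1\theta^{-1})}{c_2N}\right)^{1/a}, & N<\dfrac{\log(c_1\theta^{-1})}{c_2},\end{cases}$$ and $c_1,c_2$ are positive constants that only depend on $a$ and $m$.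
   Context: $\Xi\subset\mathbb R^m$ is compact and $\mathcal M(\Xi)$ is the set of probability distributions on $\Xi$ with bounded first and second order moments. $\mathbb P^\star\in\mathcal M(\Xi)$ is absolutely continuous with respect to Lebesgue measure and light-tailed with exponent $a>1$, i.e. $\mathbb E_{\xi\sim\mathbb P^\star}[\exp(\|\xi\|^a)]<\infty$. The constants $c_1,c_2$ are those of the known concentration result for the empirical distribution $\hat{\mathbb P}^N=\frac1N\sum_k\delta_{\hat\xi^{(k)}}$: with $\epsilon$ given by the displayed formula, $\Pr\{\mathbb P^\star\in\mathcal B_\epsilon(\hat{\mathbb P}^N)\}\ge1-\theta$. $h=[h_1^\top,\dots,h_n^\top]^\top$ and $\hat{\mathbb P}_h^N=\frac1N\sum_{k=1}^N\delta_{h(\hat\xi^{(k)})}$. The Wasserstein distance is $d_W(\mathbb Q_1,\mathbb Q_2)=\inf_{\pi\in\Pi(\mathbb Q_1,\mathbb Q_2)}\int\|\xi_1-\xi_2\|_1\,\pi(d\xi_1,d\xi_2)$ ($\Pi$: couplings), and for $\mathbb P\in\mathcal M(\Xi)$, $\mathcal B_\varepsilon(\mathbb P)=\{\mathbb Q\in\mathcal M(\Xi):d_W(\mathbb Q,\mathbb P)\le\varepsilon\}$. Inferable observations: for a covariance matrix $\Sigma$ let $\hat{\mathbb P}_\Sigma^N=\frac1N\sum_{k=1}^N\mathcal N(\hat\xi^{(k)},\Sigma)$ (mixture of Gaussians with means $\hat\xi^{(k)}$ and covariance $\Sigma$). Consider any sequence of (covariance) matrices $\{\Sigma_l\}_{l\ge1}$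 with $\Sigma_l\to O$ (the zero matrix) as $l\to\infty$. For each $l$ let $\mathcal T_l=\{T: T_\sharp\hat{\mathbb P}_{\Sigma_l}^N=\mathbb P^\star\}$, the measurable maps $T:\mathbb R^m\to\mathbb R^m$ pushing $\hat{\mathbb P}_{\Sigma_l}^N$ forward to $\mathbb P^\star$. Suppose $h$ is such that for all $T\in\mathcal T_l$, $$\int_{\mathbb R^m}\|\xi-h(\xi)\|_1\,\hat{\mathbb P}_{\Sigma_l}^N(d\xi)\le C_l\int_{\mathbb R^m}\|\xi-T(\xi)\|_1\,\hat{\mathbb P}_{\Sigma_l}^N(d\xi).$$ Then $h$ is called inferable with inflation $C$ if $\lim_{l\to\infty}C_l=C$. *)

(* Defs.v *)
From HB Require Import structures.
From mathcomp Require Import all_boot all_order all_algebra.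
From mathcomp Require Import all_classical all_reals all_analysis.
From mathcomp Require Import measurable_realfun.
Set Implicit Arguments.
Unset Strict Implicit.
Unset Printing Implicit Defensive.
Import Order.TTheory GRing.Theory Num.Theory.
Import numFieldNormedType.Exports.
Local Open Scope classical_set_scope.
Local Open Scope ring_scope.

(* Row vectors carry the product sigma-algebra of the coordinates, exactly as
   n.-tuple does in the library; on R^m this is the Borel sigma-algebra. *)
Definition rV_display : measure_display -> measure_display.
Proof. exact. Qed.

Section measurable_rV.
Context {R : realType} {m : nat}.

Let coord (i : 'I_m) (v : 'rV[R]_m) : measurableTypeR R := v ord0 i.

Let rV_set0 : g_sigma_preimage coord set0.
Proof. exact: sigma_algebra0. Qed.

Let rV_setC A : g_sigma_preimage coord A -> g_sigma_preimage coord (~` A).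
Proof. exact: sigma_algebraC. Qed.

Let rV_bigcup (F : _^nat) : (forall i, g_sigma_preimage coord (F i)) ->
  g_sigma_preimage coord (\bigcup_i (F i)).
Proof. exact: sigma_algebra_bigcup. Qed.

HB.instance Definition _ := @isMeasurable.Build
  (rV_display (measure_tuple_display default_measure_display)) 'rV[R]_m
  (g_sigma_preimage coord) rV_set0 rV_setC rV_bigcup.

End measurable_rV.

Section measurable_fun_rV.
Context {R : realType}.

Lemma measurable_coord m (i : 'I_m) :
  measurable_fun [set: 'rV[R]_m] (fun v : 'rV[R]_m => v ord0 i).
Proof.
move=> _ Y mY; rewrite setTI; apply: sub_sigma_algebra => /=.
rewrite -bigcup_seq/=; exists i => /=; first by rewrite mem_index_enum.
by exists Y => //; rewrite setTI.
Qed.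

Lemma measurable_fun_rVP d (T : measurableType d) m (f : T -> 'rV[R]_m) :
  (forall i, measurable_fun setT (fun x => f x ord0 i)) ->
  measurable_fun setT f.
Proof.
move=> mf _ A mA; rewrite setTI.
pose c (i : 'I_m) (v : 'rV[R]_m) : measurableTypeR R := v ord0 i.
have : g_sigma_preimage (fun i => c i \o f) `<=` (measurable : set (set T)).
  apply: smallest_sub; first exact: sigma_algebra_measurable.
  rewrite -bigcup_seq; apply: bigcup_sub => i _ B [Y mY <-].
  exact: mf.
by apply; rewrite g_sigma_preimage_comp; exists A => //; rewrite setTI.
Qed.

End measurable_fun_rV.

Lemma product_measure1_sigma_finite d1 d2 (T1 : measurableType d1)
    (T2 : measurableType d2) (R : realType)
    (m1 : {sigma_finite_measure set T1 -> \bar R})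
    (m2 : {sigma_finite_measure set T2 -> \bar R}) :
  sigma_finite setT (m1 \x m2)%E.
Proof.
have /sigma_finiteP[F [TF ndF Foo]] := sigma_finiteT m1.
have /sigma_finiteP[G [TG ndG Goo]] := sigma_finiteT m2.
exists (fun n => F n `*` G n).
  rewrite -setXTT TF TG predeqE => -[x y]; split.
    move=> [/= [n _ Fnx] [k _ Gky]]; exists (maxn n k) => //; split.
    - by move: x Fnx; exact/subsetPset/ndF/leq_maxl.
    - by move: y Gky; exact/subsetPset/ndG/leq_maxr.
  by move=> [n _ []/= ? ?]; split; exists n.
move=> k; have [? ?] := Foo k; have [? ?] := Goo k.
split; first exact: measurableX.
by rewrite product_measure1E// lte_mul_pinfty// ge0_fin_numE.
Qed.

Section power_measure.
Context {R : realType}.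
Local Open Scope ereal_scope.

Definition consv m (p : measurableTypeR R * 'rV[R]_m) : 'rV[R]_m.+1 :=
  row_mx (p.1%:M : 'rV[R]_1) p.2.

Lemma measurable_consv m : measurable_fun setT (@consv m).
Proof.
apply: measurable_fun_rVP => i; rewrite /consv.
case: (@splitP 1 m i) => j ij.
- have -> : (fun x : measurableTypeR R * 'rV[R]_m => (row_mx (x.1%:M : 'rV[R]_1) x.2
      : 'rV[R]_m.+1) ord0 i) = fst.
    apply/funext => x; have -> : i = lshift m j by apply/val_inj.
    by rewrite (@row_mxEl _ 1 1 m) mxE !ord1 mulr1n.
  exact: measurable_fst.
- have -> : (fun x : measurableTypeR R * 'rV[R]_m => (row_mx (x.1%:M : 'rV[R]_1) x.2
      : 'rV[R]_m.+1) ord0 i) = (fun v : 'rV[R]_m => v ord0 j) \o snd.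
    apply/funext => x; have -> : i = rshift 1 j by apply/val_inj.
    by rewrite (@row_mxEr _ 1 1 m).
  by apply: measurableT_comp => //; exact: measurable_coord.
Qed.

Definition cons_measure m (mu : set (measurableTypeR R) -> \bar R)
    (nu : set 'rV[R]_m -> \bar R) : set 'rV[R]_m.+1 -> \bar R :=
  pushforward (mu \x nu) (@consv m).

Section cons_measure_sigma_finite.
Variables (m : nat) (mu : {sigma_finite_measure set (measurableTypeR R) -> \bar R}).
Variable nu : {sigma_finite_measure set 'rV[R]_m -> \bar R}.

Let rho := measure_function_pushforward__canonical__measure_function_Measure
  (mu \x nu) (@measurable_consv m).

Let cons_measure0 : cons_measure mu nu set0 = 0.
Proof. exact: (measure0 rho). Qed.

Let cons_measure_ge0 A : 0 <= cons_measure mu nu A.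
Proof. exact: (measure_ge0 rho). Qed.

Let cons_measure_sigma_additive : semi_sigma_additive (cons_measure mu nu).
Proof. exact: (@measure_semi_sigma_additive _ _ _ rho). Qed.

HB.instance Definition _ := isMeasure.Build _ _ _ (cons_measure mu nu)
  cons_measure0 cons_measure_ge0 cons_measure_sigma_additive.

Let cons_measure_sigma_finite : sigma_finite setT (cons_measure mu nu).
Proof.
have [F UF Foo] := product_measure1_sigma_finite mu nu.
pose g (w : 'rV[R]_m.+1) : measurableTypeR R * 'rV[R]_m :=
  (w ord0 ord0, \row_i w ord0 (lift ord0 i)).
have gK : cancel (@consv m) g.
  move=> [x v]; congr pair => /=.
    have -> : ord0 = lshift m (ord0 : 'I_1) by apply/val_inj.
    by rewrite (@row_mxEl _ 1 1 m) mxE mulr1n.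
  apply/rowP => i; rewrite mxE.
  have -> : lift ord0 i = rshift 1 i by apply/val_inj.
  by rewrite (@row_mxEr _ 1 1 m).
have mg : measurable_fun setT g.
  apply/measurable_fun_pairP; split; first exact: measurable_coord.
  apply: measurable_fun_rVP => i.
  rewrite (_ : (fun _ => _) = (fun v : 'rV[R]_m.+1 => v ord0 (lift ord0 i))).
    exact: measurable_coord.
  by apply/funext => x; rewrite /= mxE.
exists (fun k => g @^-1` F k).
  by rewrite -preimage_bigcup -UF preimage_setT.
move=> k; have [mF Fk] := Foo k; split.
  by rewrite -[X in measurable X]setTI; exact: mg.
rewrite /cons_measure /pushforward (_ : _ @^-1` _ = F k) //.
by apply/seteqP; split => x /=; rewrite gK.
Qed.

HB.instance Definition _ := Measure_isSigmaFinite.Build _ _ _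
  (cons_measure mu nu) cons_measure_sigma_finite.

End cons_measure_sigma_finite.

(* m-fold product of mu with itself, by R^m.+1 = R x R^m; in dimension 0 the
   space is a single point. *)
Fixpoint power_measure (mu : set (measurableTypeR R) -> \bar R) (m : nat) :
    set 'rV[R]_m -> \bar R :=
  match m with
  | 0%N => \d_(0%R : 'rV[R]_0)
  | m'.+1 => cons_measure mu (@power_measure mu m')
  end.

End power_measure.
Arguments power_measure {R} mu m.

Section power_measure_sigma_finite.
Context {R : realType}.
Local Open Scope ereal_scope.
Variables (mu : {sigma_finite_measure set (measurableTypeR R) -> \bar R}) (m : nat).

Let power_measureE :
  exists nu : {sigma_finite_measure set 'rV[R]_m -> \bar R},
    power_measure mu m = nu.
Proof.
elim: m => [|k [nu nuE]] /=; first by exists (\d_(0%R : 'rV[R]_0)).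
by rewrite nuE; exists (cons_measure mu nu).
Qed.

Let power_measure0 : power_measure mu m set0 = 0.
Proof. by have [nu ->] := power_measureE. Qed.

Let power_measure_ge0 A : 0 <= power_measure mu m A.
Proof. by have [nu ->] := power_measureE. Qed.

Let power_measure_sigma_additive : semi_sigma_additive (power_measure mu m).
Proof.
by have [nu ->] := power_measureE; exact: measure_semi_sigma_additive.
Qed.

HB.instance Definition _ := isMeasure.Build _ _ _ (power_measure mu m)
  power_measure0 power_measure_ge0 power_measure_sigma_additive.

Let power_measure_sigma_finite : sigma_finite setT (power_measure mu m).
Proof. by have [nu ->] := power_measureE; exact: sigma_finiteT. Qed.

HB.instance Definition _ := Measure_isSigmaFinite.Build _ _ _
  (power_measure mu m) power_measure_sigma_finite.

End power_measure_sigma_finite.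

Section mixture.
Context d (T : measurableType d) (R : realType) (N : nat).
Local Open Scope ereal_scope.
Variable mu_ : 'I_N -> {measure set T -> \bar R}.

Definition mixture (A : set T) : \bar R :=
  (N%:R^-1)%:E * \sum_(k < N) mu_ k A.

Let N_ge0 : 0 <= (N%:R^-1 : R)%:E.
Proof. by rewrite lee_fin invr_ge0. Qed.

Let mixture0 : mixture set0 = 0.
Proof. by rewrite /mixture big1 ?mule0. Qed.

Let mixture_ge0 A : 0 <= mixture A.
Proof. by rewrite mule_ge0// sume_ge0. Qed.

Let mixture_sigma_additive : semi_sigma_additive mixture.
Proof.
move=> F mF tF mUF.
have -> : mixture (\bigcup_n F n) = \sum_(n <oo) mixture (F n).
  rewrite nneseriesZl//; last by move=> i _; exact: sume_ge0.
  rewrite nneseries_sum//; congr (_ * _); apply: eq_bigr => k _.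
  exact: measure_semi_bigcup.
by apply: is_cvg_ereal_nneg_natsum => k _; exact: mixture_ge0.
Qed.

HB.instance Definition _ := isMeasure.Build _ _ _ mixture
  mixture0 mixture_ge0 mixture_sigma_additive.

End mixture.

Section lebesgue_gaussian_rV.
Variables (R : realType) (m : nat).

Definition lebesgue_rV : set 'rV[R]_m -> \bar R :=
  power_measure lebesgue_measure m.

HB.instance Definition _ := SigmaFiniteMeasure.on lebesgue_rV.

Definition std_gaussian : set 'rV[R]_m -> \bar R :=
  power_measure (normal_prob 0%R 1%R) m.

HB.instance Definition _ := SigmaFiniteMeasure.on std_gaussian.

End lebesgue_gaussian_rV.
Arguments lebesgue_rV {R} m.
Arguments std_gaussian {R} m.

Section gaussian.
Context {R : realType}.
Local Open Scope ereal_scope.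

Definition covariance_mx m (Sigma : 'M[R]_m) : Prop :=
  Sigma^T = Sigma /\
  forall u : 'rV[R]_m, (0 <= (u *m Sigma *m u^T) ord0 ord0)%R.

(* For a covariance matrix Sigma the positive semidefinite root exists and is
   unique; otherwise the value is irrelevant. *)
Definition sqrtmx m (Sigma : 'M[R]_m) : 'M[R]_m :=
  xget 0%R [set A | covariance_mx A /\ A *m A = Sigma].

Section gaussian_measure.
Variables (m : nat) (mean : 'rV[R]_m) (Sigma : 'M[R]_m).

(* The law of mean + Sigma^(1/2) z for standard Gaussian z, on row vectors; it
   makes sense for singular Sigma too. *)
Definition gaussian : set 'rV[R]_m -> \bar R :=
  pushforward (std_gaussian m) (fun z => mean + z *m sqrtmx Sigma)%R.

Let measurable_affine : measurable_fun setT
  (fun z : 'rV[R]_m => mean + z *m sqrtmx Sigma)%R.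
Proof.
apply: measurable_fun_rVP => i.
rewrite (_ : (fun _ => _) = (cst (mean ord0 i) \+
    \sum_(j < m) (fun z : 'rV[R]_m => z ord0 j * sqrtmx Sigma j i))%R); last first.
  by apply/funext => z; rewrite !mxE /= fct_sumE.
apply: measurable_funD; first exact: measurable_cst.
elim/big_ind : _ => [|f g mf mg|j _]; first exact: measurable_cst.
  exact: measurable_funD.
by apply: measurable_funM => //; exact: measurable_coord.
Qed.

Let nu := measure_function_pushforward__canonical__measure_function_Measure
  (std_gaussian m) measurable_affine.

Let gaussian0 : gaussian set0 = 0. Proof. exact: (measure0 nu). Qed.

Let gaussian_ge0 A : 0 <= gaussian A. Proof. exact: (measure_ge0 nu). Qed.

Let gaussian_sigma_additive : semi_sigma_additive gaussian.
Proof. exact: (@measure_semi_sigma_additive _ _ _ nu). Qed.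

HB.instance Definition _ := isMeasure.Build _ _ _ gaussian
  gaussian0 gaussian_ge0 gaussian_sigma_additive.

End gaussian_measure.

End gaussian.

Section definitions.
Context {R : realType}.
Local Open Scope ereal_scope.
Implicit Types (m n N : nat).

Definition norm1 m (v : 'rV[R]_m) : R := (\sum_(i < m) `|v ord0 i|)%R.

Definition norm2 m (v : 'rV[R]_m) : R :=
  Num.sqrt (\sum_(i < m) v ord0 i ^+ 2)%R.

(* Distributions on Xi are seen as distributions on R^m giving no mass to the
   complement of Xi. *)
Definition distributions_on m (Xi : set 'rV[R]_m) : set (probability 'rV[R]_m R) :=
  [set Q | [/\ Q (~` Xi) = 0,
               \int[Q]_x (norm2 x)%:E < +oo &
               \int[Q]_x (norm2 x ^+ 2)%:E < +oo]].

Definition light_tailed m (a : R) (P : probability 'rV[R]_m R) : Prop :=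
  \int[P]_x (expR (norm2 x `^ a))%:E < +oo.

Definition couplings m (Q1 Q2 : set 'rV[R]_m -> \bar R) :
    set (probability ('rV[R]_m * 'rV[R]_m)%type R) :=
  [set pi | forall A, measurable A ->
     pushforward pi fst A = Q1 A /\ pushforward pi snd A = Q2 A].

Definition wasserstein m (Q1 Q2 : set 'rV[R]_m -> \bar R) : \bar R :=
  ereal_inf [set \int[pi]_z (norm1 (z.1 - z.2))%:E | pi in couplings Q1 Q2].

(* Members of the ball live on Xi; the center P need not (the observed points
   h (x k) may leave Xi). *)
Definition wball m (Xi : set 'rV[R]_m) (eps : R)
    (P : set 'rV[R]_m -> \bar R) : set (probability 'rV[R]_m R) :=
  [set Q | distributions_on Xi Q /\ wasserstein Q P <= eps%:E].

Definition empirical m N (x : 'I_N -> 'rV[R]_m) : set 'rV[R]_m -> \bar R :=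
  mixture (fun k => \d_(x k)).

HB.instance Definition _ m N (x : 'I_N -> 'rV[R]_m) :=
  Measure.on (empirical x).

Definition gaussian_mixture m N (x : 'I_N -> 'rV[R]_m) (Sigma : 'M[R]_m) :
    set 'rV[R]_m -> \bar R :=
  mixture (fun k => gaussian (x k) Sigma).

HB.instance Definition _ m N (x : 'I_N -> 'rV[R]_m) (Sigma : 'M[R]_m) :=
  Measure.on (gaussian_mixture x Sigma).

Definition transport_maps m (mu nu : set 'rV[R]_m -> \bar R) :
    set ('rV[R]_m -> 'rV[R]_m) :=
  [set T | measurable_fun setT T /\
           forall A, measurable A -> pushforward mu T A = nu A].

(* The sample x is fixed; the constants C_ may depend on the sequence Sigma_
   (and on x), but not on T. *)
Definition inferable m N (P : probability 'rV[R]_m R) (x : 'I_N -> 'rV[R]_m)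
    (h : 'rV[R]_m -> 'rV[R]_m) (C : R) : Prop :=
  forall Sigma_ : nat -> 'M[R]_m,
    (forall l, covariance_mx (Sigma_ l)) ->
    Sigma_ l @[l --> \oo] --> (0%R : 'M[R]_m) ->
  exists C_ : nat -> R,
    (forall l T, transport_maps (gaussian_mixture x (Sigma_ l)) P T ->
       \int[gaussian_mixture x (Sigma_ l)]_xi (norm1 (xi - h xi))%:E <=
       (C_ l)%:E *
         \int[gaussian_mixture x (Sigma_ l)]_xi (norm1 (xi - T xi))%:E) /\
    C_ l @[l --> \oo] --> C.

Definition iid d (Omega : measurableType d) (Pr : probability Omega R) m N
    (P : probability 'rV[R]_m R) (X : 'I_N -> {RV Pr >-> 'rV[R]_m}) : Prop :=
  (forall k A, measurable A -> distribution Pr (X k) A = P A) /\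
  (forall (J : {set 'I_N}) (A : 'I_N -> set 'rV[R]_m),
     (forall k, measurable (A k)) ->
     Pr [set omega | forall k, k \in J -> A k (X k omega)] =
     \prod_(k in J) Pr (X k @^-1` A k)).

Definition stack m n (p : 'I_n -> nat) (pm : (\sum_(i < n) p i)%N = m)
    (h_ : forall i, 'rV[R]_m -> 'rV[R]_(p i)) (x : 'rV[R]_m) : 'rV[R]_m :=
  castmx (erefl 1%N, pm) (\mxrow_(i < n) h_ i x).

End definitions.

Definition concentration_radius (R : realType) (a : R) (m N : nat) (c1 c2 theta : R) : R :=
  let L := ln (c1 * theta^-1) in
  if (L / c2 <= N%:R) then (L / (c2 * N%:R)) `^ ((maxn m 2)%:R^-1)
  else (L / (c2 * N%:R)) `^ (a^-1).

(* Main.v *)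
Require Import Defs.
From HB Require Import structures.
From mathcomp Require Import all_boot all_order all_algebra.
From mathcomp Require Import all_classical all_reals all_analysis.
From mathcomp Require Import measurable_realfun ring lra.
Import Order.TTheory GRing.Theory Num.Theory.
Import numFieldNormedType.Exports.
Set Implicit Arguments.
Unset Strict Implicit.
Unset Printing Implicit Defensive.
Local Open Scope classical_set_scope.
Local Open Scope ring_scope.

(* Only the degenerate covariances s^2 E_11 with s -> 0 are used.  For them the
   Gaussian mixture is carried by the lines x_k + R e_1 and is the image of
   N one-dimensional Gaussians.  A coupling of Pstar with the empirical measure
   splits Pstar into N pieces nu_k of mass 1/N; transporting each Voronoi cell of
   the sample, through its first coordinate, to the matching combination of the
   nu_k gives a map T from the mixture to Pstar whose cost exceeds that of the
   coupling by at most 3 s E|t|.  Inferability then bounds the mean of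
   f = |v - h v| under the mixture by C_l times this cost.  By Lebesgue's density
   theorem along the lines (h is merely measurable, but Pstar has a density), for
   almost every sample these means are asymptotically at least
   (1/N) sum_k f(x_k), so that (1/N) sum_k f(x_k) <= C eps, and the triangle
   inequality concludes.  The events whose probabilities are compared are
   measurable because the Wasserstein distance to the empirical measure is
   Lipschitz in the sample. *)

(** * Gaussian mixtures with covariance s^2 E_11 *)

(** Inferability quantifies over all sequences of positive semidefinite matrices tending to 0,
    singular ones included, so a rank-one sequence may be chosen; it reduces both the construction
    of maps and the differentiation of [f] to one real variable. A map [T] sees the point [v] but
    not the component that produced it, and the lines [x_k + R e_1] may coincide. Hence the Voronoi
    cells, where mass of component [k] may spill into the cell of another point: of the 3 in the
    excess cost, 1 pays for the way from [v] to the nearest sample point and 2 for the spill. The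
    first coordinate alone can serve as source of randomness because its law under the mixture has
    no atoms. The constants [C_ l] do not depend on [T], so the near-optimal coupling may be chosen
    after them. As [f] need be neither continuous nor integrable, only a lower bound on its Gaussian
    means is sought, and only along the widths 1/(l+1): the set of good points is then measurable,
    and one null set serves all [l]. *)

Section degenerate_gaussian.
Context {R : realType}.
Implicit Types (m N : nat) (s t : R).

Definition axis m t : 'rV[R]_m.+1 := t *: delta_mx ord0 ord0.

Definition axis_cov m s : 'M[R]_m.+1 := s ^+ 2 *: delta_mx ord0 ord0.

Lemma axisE m t i : axis m t ord0 i = t * (i == ord0)%:R.
Proof. by rewrite !mxE eqxx. Qed.

Lemma mulmx_scale_delta m (u : 'rV[R]_m.+1) (c : R) :
  u *m (c *: delta_mx ord0 ord0 : 'M[R]_m.+1) = axis m (u ord0 ord0 * c).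
Proof.
apply/rowP => j; rewrite axisE mxE (bigD1 ord0)//= big1 ?addr0.
  by rewrite !mxE eqxx/= mulrA.
by move=> i /negbTE i0; rewrite !mxE i0/= !mulr0.
Qed.

Lemma covariance_scale_delta m (c : R) : 0 <= c ->
  covariance_mx (c *: delta_mx ord0 ord0 : 'M[R]_m.+1).
Proof.
move=> c0; split; first by rewrite linearZ/= trmx_delta.
move=> u; rewrite mulmx_scale_delta mxE (bigD1 ord0)//= big1 ?addr0.
  by rewrite axisE eqxx mulr1 mxE mulrAC mulr_ge0// -expr2 sqr_ge0.
by move=> i /negbTE i0; rewrite axisE i0 mulr0 mul0r.
Qed.

(** [xget] picks an unspecified root, so every positive semidefinite root has to be determined. By
    symmetry the squared norm of row [i] of [A] is the entry [(i, i)] of [A *m A], which vanishes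
    for [i != ord0]; only the corner entry survives, and semidefiniteness fixes its sign. *)
Lemma sqrtmx_axis_cov m s : 0 <= s ->
  sqrtmx (axis_cov m s) = s *: delta_mx ord0 ord0.
Proof.
move=> s0; rewrite /sqrtmx; case: xgetP => [A _|].
  move=> [[AT Apos] AA].
  have Asym i j : A i j = A j i by rewrite -[in LHS]AT mxE.
  have Adiag i : \sum_j A i j ^+ 2 = s ^+ 2 * ((i == ord0) && (i == ord0))%:R.
    have := congr1 (fun B : 'M[R]_m.+1 => B i i) AA; rewrite !mxE => <-.
    by apply: eq_bigr => j _; rewrite (Asym j i) expr2.
  have A0 i j : i != ord0 -> A i j = 0.
    move=> /negbTE i0; have := Adiag i; rewrite i0 mulr0 => /eqP.
    rewrite psumr_eq0; last by move=> k _; rewrite sqr_ge0.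
    by move=> /allP/(_ j); rewrite mem_index_enum sqrf_eq0 => /(_ isT)/eqP.
  have A00 : A ord0 ord0 = s.
    have := Adiag ord0; rewrite eqxx mulr1 (bigD1 ord0)//= big1 ?addr0; last first.
      by move=> i i0; rewrite Asym A0// expr0n.
    move=> /eqP; rewrite eqrXn2// => [/eqP//|].
    have := Apos (delta_mx ord0 ord0).
    by rewrite -rowE trmx_delta -colE !mxE.
  apply/matrixP => i j; rewrite !mxE.
  have [->|i0] := eqVneq i ord0; last by rewrite A0// mulr0.
  have [->|j0] := eqVneq j ord0; first by rewrite A00 mulr1.
  by rewrite Asym A0// mulr0.
move=> /(_ (s *: delta_mx ord0 ord0)) []; split.
  exact: covariance_scale_delta.
by rewrite -scalemxAl -scalemxAr scalerA mul_delta_mx -expr2.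
Qed.

Lemma measurable_axis_line m (x : 'rV[R]_m.+1) s :
  measurable_fun setT (fun t : measurableTypeR R => x + axis m (t * s)).
Proof.
apply: measurable_fun_rVP => i.
rewrite (_ : (fun _ => _) = fun t => x ord0 i + t * s * (i == ord0)%:R).
  by apply: measurable_funD => //; apply: measurable_funM => //; exact: measurable_funM.
by apply/funext => t; rewrite mxE axisE.
Qed.

Lemma power_measure_setT m :
  power_measure (normal_prob (0 : R) 1) m setT = 1%E.
Proof.
elim: m => [|m IH]; first by rewrite /= diracT.
rewrite /= /cons_measure /pushforward preimage_setT -setXTT.
rewrite product_measure1E//; rewrite [X in (_ * X)%E]IH mule1; exact: probability_setT.
Qed.

(** The root [s E_11] forgets every coordinate of the standard Gaussian vector except the first, so
    the event is a cylinder over the first factor of the product measure. *)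
Lemma gaussian_axis m (x : 'rV[R]_m.+1) s (A : set 'rV[R]_m.+1) :
  0 <= s -> measurable A ->
  gaussian x (axis_cov m s) A
  = normal_prob 0 1 [set t : measurableTypeR R | A (x + axis m (t * s))].
Proof.
move=> s0 mA; rewrite /gaussian sqrtmx_axis_cov// /pushforward /std_gaussian /=.
rewrite /cons_measure /pushforward.
set B := [set t | _].
have -> : @consv R m @^-1` ((fun z => x + z *m (s *: delta_mx ord0 ord0)) @^-1` A)
    = B `*` setT.
  apply/seteqP; split=> -[t y]; rewrite /= mulmx_scale_delta /consv/=.
    have -> : (ord0 : 'I_m.+1) = lshift m (ord0 : 'I_1) by apply/val_inj.
    rewrite (@row_mxEl _ 1 1 m) mxE mulr1n => ?; split => //.
  move=> [+ _]; rewrite /B/=.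
  have -> : (ord0 : 'I_m.+1) = lshift m (ord0 : 'I_1) by apply/val_inj.
  by rewrite (@row_mxEl _ 1 1 m) mxE mulr1n.
have mB : measurable B.
  by rewrite -[B]setTI; apply: measurable_axis_line.
rewrite product_measure1E//. rewrite [X in (_ * X)%E]power_measure_setT mule1//.
Qed.

End degenerate_gaussian.

Section integral_combination.
Context d (T : measurableType d) (R : realType).
Local Open Scope ereal_scope.

Lemma ge0_integral_lincomb (N : nat) (c : 'I_N -> R)
    (mu_ : 'I_N -> {measure set T -> \bar R}) (mu : {measure set T -> \bar R})
    (f : T -> \bar R) :
  (forall k, 0 <= c k)%R ->
  (forall A, measurable A -> mu A = \sum_(k < N) (c k)%:E * mu_ k A) ->
  measurable_fun setT f -> (forall x, 0 <= f x) ->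
  \int[mu]_x f x = \sum_(k < N) (c k)%:E * \int[mu_ k]_x f x.
Proof.
move=> c0 muE mf f0.
pose m_ (n : nat) : {measure set T -> \bar R} :=
  if insub n is Some k then mscale (NngNum (c0 k)) (mu_ k) else mzero.
rewrite (eq_measure_integral (msum m_ N)); last first.
  move=> A mA _; rewrite muE//; apply: eq_bigr => k _ /=.
  by rewrite /m_ valK.
rewrite ge0_integral_measure_sum//; apply: eq_bigr => k _.
by rewrite /m_ valK ge0_integral_mscale.
Qed.

End integral_combination.

Section gaussian_mixture_integral.
Context {R : realType}.
Local Open Scope ereal_scope.

Lemma gaussian_mixture_axis m N (x : 'I_N -> 'rV[R]_m.+1) s A :
  (0 <= s)%R -> measurable A ->
  gaussian_mixture x (axis_cov m s) A =
  \sum_(k < N) (N%:R^-1)%:E *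
    normal_prob 0 1 [set t : measurableTypeR R | A (x k + axis m (t * s))%R].
Proof.
move=> s0 mA; rewrite /gaussian_mixture /mixture ge0_sume_distrr//.
by apply: eq_bigr => k _; rewrite -gaussian_axis.
Qed.

Lemma integral_gaussian_mixture_axis m N (x : 'I_N -> 'rV[R]_m.+1) s
    (f : 'rV[R]_m.+1 -> \bar R) :
  (0 <= s)%R -> measurable_fun setT f -> (forall v, 0 <= f v) ->
  \int[gaussian_mixture x (axis_cov m s)]_v f v =
  \sum_(k < N) (N%:R^-1)%:E *
    \int[normal_prob 0 1]_(t in [set: measurableTypeR R])
       f (x k + axis m (t * s))%R.
Proof.
move=> s0 mf f0.
pose L k (t : measurableTypeR R) := (x k + axis m (t * s))%R.
have mL k : measurable_fun setT (L k) by exact: measurable_axis_line.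
pose nu k := measure_function_pushforward__canonical__measure_function_Measure
  (normal_prob 0 1) (mL k).
rewrite (@ge0_integral_lincomb _ _ _ N (fun=> N%:R^-1%R) nu)//.
- apply: eq_bigr => k _; congr (_ * _).
  by rewrite ge0_integral_pushforward// => ?.
- by move=> A mA; apply: etrans (gaussian_mixture_axis x s0 mA) _.
Qed.

End gaussian_mixture_integral.

(** * Transport from an atomless law on the line *)

Section quantile_transport.
Context {R : realType}.
Local Open Scope ereal_scope.

Section cdf_limits.
Variable mu : {finite_measure set (measurableTypeR R) -> \bar R}.

Let cdf_le r s : (r <= s)%R -> mu `]-oo, r]%classic <= mu `]-oo, s]%classic.
Proof. by move=> rs; apply: le_measure; rewrite ?inE//; exact: subset_itvl. Qed.

Let itvNyo_bigcup (r : R) :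
  `]-oo, r[%classic = \bigcup_n `]-oo, (r - n.+1%:R^-1)%R]%classic.
Proof.
apply/seteqP; split => [x/=|x [n _]/=]; rewrite !in_itv/=.
  by move=> /ltr_add_invr[k xk]; exists k => //=; rewrite in_itv/= lerBrDr ltW.
by move=> /le_lt_trans; apply; rewrite gtrBl.
Qed.

Lemma cvg_cdf_left r :
  mu `]-oo, (r - n.+1%:R^-1)%R]%classic @[n --> \oo] --> mu `]-oo, r[%classic.
Proof.
rewrite itvNyo_bigcup.
apply: (@nondecreasing_cvg_mu _ (measurableTypeR R) _ mu) => //.
- by rewrite -itvNyo_bigcup.
- move=> i j ij; apply/subsetPset/subset_itvl; rewrite bnd_simp lerD2l lerN2.
  by rewrite lef_pV2 ?posrE// ler_nat.
Qed.

Lemma cdf_left_le r u :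
  (forall n, mu `]-oo, (r - n.+1%:R^-1)%R]%classic <= u) -> mu `]-oo, r[%classic <= u.
Proof.
by move=> h; have /cvge_to_le := @cvg_cdf_left r; apply; exact: nearW.
Qed.

Lemma cdf_right_ge r u :
  (forall n, u <= mu `]-oo, (r + n.+1%:R^-1)%R]%classic) -> u <= mu `]-oo, r]%classic.
Proof.
move=> h; have : mu `]-oo, (r + n.+1%:R^-1)%R]%classic @[n --> \oo] --> mu `]-oo, r]%classic.
  rewrite (itvNycEbigcap false).
  apply: (@nonincreasing_cvg_mu _ (measurableTypeR R) _ mu) => //.
  - by rewrite -ge0_fin_numE// fin_num_measure.
  - by rewrite -itvNycEbigcap.
  - move=> i j ij; apply/subsetPset/subset_itvl; rewrite bnd_simp lerD2l.
    by rewrite lef_pV2 ?posrE// ler_nat.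
by move=> /cvge_to_ge; apply; exact: nearW.
Qed.

Lemma cdf_top_le u : (forall n : nat, mu `]-oo, n%:R]%classic <= u) -> mu setT <= u.
Proof.
move=> h.
have E : \bigcup_n `]-oo, n%:R]%classic = [set: R].
  apply/seteqP; split => // x _; exists (Num.truncn x).+1 => //=.
  by rewrite in_itv/= ltW// truncnS_gt.
have : mu `]-oo, n%:R]%classic @[n --> \oo] --> mu setT.
  rewrite -E; apply: (@nondecreasing_cvg_mu _ (measurableTypeR R) _ mu) => //.
  - by rewrite E.
  - by move=> i j ij; apply/subsetPset/subset_itvl; rewrite bnd_simp ler_nat.
by move=> /cvge_to_le; apply; exact: nearW.
Qed.

Lemma cdf_bot_ge u : (forall n : nat, u <= mu `]-oo, (- n%:R)%R]%classic) -> u <= 0.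
Proof.
move=> h.
have E : \bigcap_n `]-oo, (- n%:R)%R]%classic = set0 :> set R.
  apply/seteqP; split => // x /(_ (Num.truncn (- x)).+1 Logic.I)/=.
  by rewrite in_itv/= lerNr leNgt truncnS_gt.
have : mu `]-oo, (- n%:R)%R]%classic @[n --> \oo] --> mu set0.
  rewrite -E; apply: (@nonincreasing_cvg_mu _ (measurableTypeR R) _ mu) => //.
  - by rewrite -ge0_fin_numE// fin_num_measure.
  - by rewrite E.
  - by move=> i j ij; apply/subsetPset/subset_itvl; rewrite bnd_simp lerN2 ler_nat.
by rewrite measure0; move=> /cvge_to_ge; apply; exact: nearW.
Qed.

Lemma measurable_cdf_level u :
  measurable ([set s | mu `]-oo, s]%classic <= u] : set (measurableTypeR R)).
Proof.
apply: is_interval_measurable => s t /= _ tu r /andP[_ rt].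
exact: le_trans (cdf_le rt) tu.
Qed.

(** Uniformity of the distribution function of an atomless law. The level set is a down-set; if it
    is neither empty nor full, the distribution function at its supremum [c] is at most [u] from the
    left and at least [u] from the right, and the two values agree because [c] has no mass. In the
    two extreme cases [u] is the limit at minus or plus infinity. *)
Lemma atomless_cdf_level u : (forall s, mu [set s] = 0) ->
  0 <= u <= mu setT -> mu [set s | mu `]-oo, s]%classic <= u] = u.
Proof.
move=> mu1 /andP[u0 uT]; set A := [set s | _].
have mA : measurable A by exact: measurable_cdf_level.
have Adown s t : (s <= t)%R -> A t -> A s.
  by move=> st; apply: le_trans; exact: cdf_le.
have [A0|/set0P[a Aa]] := eqVneq A set0.
  rewrite A0 measure0; apply/esym/eqP; rewrite eq_le u0 andbT.
  apply: cdf_bot_ge => n; rewrite leNgt; apply/negP => /ltW An.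
  by have : A (- n%:R)%R := An; rewrite A0.
have [[b Ab]|An] := pselect (exists b, ~ A b); last first.
  have AT s : A s by apply: contrapT => As; apply: An; exists s.
  rewrite (_ : A = setT); last by apply/seteqP; split => // s _; exact: AT.
  apply/eqP; rewrite eq_le uT andbT; apply: cdf_top_le => n; exact: (AT n%:R).
have supA : has_sup A.
  split; first by exists a.
  by exists b => s As; rewrite leNgt; apply/negP => /ltW bs; apply: Ab; exact: Adown bs As.
pose c := sup A.
have muc : mu `]-oo, c]%classic = mu `]-oo, c[%classic.
  rewrite -(@setUitv1 _ _ _ _ true)//= measureU//=; first by rewrite mu1 adde0.
  by apply/seteqP; split => // x /= [] /[swap] ->; rewrite in_itv/= ltxx.
have le_u : mu `]-oo, c[%classic <= u.
  apply: cdf_left_le => n.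
  have n0 : (0 < n.+1%:R^-1 :> R)%R by rewrite invr_gt0 ltr0n.
  have [s As cs] := sup_adherent n0 supA.
  exact: (Adown _ _ (ltW cs) As).
have ge_u : u <= mu `]-oo, c]%classic.
  apply: cdf_right_ge => n; rewrite leNgt; apply/negP => /ltW Ac.
  have := ub_le_sup supA.2 Ac; rewrite leNgt => /negP; apply.
  by rewrite ltrDl.
apply/eqP; rewrite eq_le; apply/andP; split.
  apply: le_trans le_u; rewrite -muc; apply: le_measure; rewrite ?inE//.
  by move=> s As; rewrite /= in_itv/=; exact: (ub_le_sup supA.2).
apply: (le_trans ge_u); rewrite muc; apply: le_measure; rewrite ?inE//.
move=> s /=; rewrite in_itv/= => sc.
have cs : (0 < c - s)%R by rewrite subr_gt0.
have [t At st] := sup_adherent cs supA.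
by apply: Adown At; rewrite ltW//; move: st; rewrite opprB addrC subrK.
Qed.

End cdf_limits.

(** Monotone rearrangement: [q] is the distribution function of [alpha] followed by the generalized
    inverse of that of [beta]. Confining [beta] to [0, 1] makes the sets whose infimum is taken
    nonempty and bounded below. *)
Lemma quantile_transport
    (alpha beta : {finite_measure set (measurableTypeR R) -> \bar R}) :
  (forall s, alpha [set s] = 0) -> beta (~` `[0%R, 1%R]%classic) = 0 ->
  alpha setT = beta setT ->
  exists2 q : measurableTypeR R -> measurableTypeR R, measurable_fun setT q &
    forall B, measurable B -> alpha (q @^-1` B) = beta B.
Proof.
move=> alpha1 beta01 abT.
have betaT (r : R) : (1 <= r)%R -> beta `]-oo, r]%classic = beta setT.
  move=> r1; apply/eqP; rewrite eq_le le_measure ?inE//=.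
  rewrite -(setUv `]-oo, r]%classic) (le_trans (measureU2 _ _ _))//=.
    exact: measurableC.
  rewrite [X in _ + X](_ : _ = 0) ?adde0//.
  apply/eqP; rewrite eq_le measure_ge0 andbT -beta01 le_measure ?inE//.
  - exact: measurableC.
  - exact: measurableC.
  - apply: subsetC => x; rewrite /= !in_itv/= => /andP[_ x1]; exact: le_trans r1.
have beta0 (r : R) : (r <= 0)%R -> beta `]-oo, r[%classic = 0.
  move=> r0; apply/eqP; rewrite eq_le measure_ge0 andbT -beta01 le_measure ?inE//.
  - exact: measurableC.
  - move=> x; rewrite /= !in_itv/= => xr.
    by apply/negP; rewrite negb_and -ltNge (lt_le_trans xr).
have beta_le r s : (r <= s)%R -> beta `]-oo, r]%classic <= beta `]-oo, s]%classic.
  by move=> rs; apply: le_measure; rewrite ?inE//; exact: subset_itvl.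
pose F s := alpha `]-oo, s]%classic.
pose S s : set R := [set r | (0 <= r)%R /\ F s <= beta `]-oo, r]%classic].
pose q (s : measurableTypeR R) : measurableTypeR R := inf (S s).
have S1 s : S s 1%R.
  by split => //; rewrite betaT// -abT le_measure ?inE.
have infS s : has_inf (S s) by split; [exists 1%R|exists 0%R => r []].
have q0 s : (0 <= q s)%R by apply: lb_le_inf; [exists 1%R|move=> r []].
have q1 s : (q s <= 1)%R by apply: ge_inf => //; exact: (infS s).2.
have q_nd : nondecreasing_fun (q : R -> R).
  move=> s t st; apply: lb_le_inf; first by exists 1%R.
  move=> r [r0 Fr]; apply: ge_inf; first exact: (infS s).2.
  split => //; apply: le_trans Fr; apply: le_measure; rewrite ?inE//.
  exact: subset_itvl.
have mq : measurable_fun setT q by exact: (nondecreasing_measurable _ q_nd).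
have mqV D : measurable D -> measurable (q @^-1` D).
  by move=> mD; rewrite -[X in measurable X]setTI; exact: mq.
exists q => // B mB.
pose nu := measure_function_pushforward__canonical__measure_function_Measure
  alpha mq.
rewrite -[LHS]/(nu B).
apply: (@measure_unique _ R (measurableTypeR R) (@RGenInftyO.G R)
  (fun n => `]-oo, n%:R[%classic)) => //.
- exact: RGenInftyO.measurableE.
- move=> _ _ [x ->] [y ->]; exists (Num.min x y).
  by apply/seteqP; split => z /=; rewrite !in_itv/= lt_min => /andP.
- by move=> n; exists n%:R.
- apply/seteqP; split => // x _; exists (Num.truncn x).+1 => //=.
  by rewrite in_itv/= truncnS_gt.
- move=> _ [r ->]; rewrite /nu/= /pushforward.
  have [r0|r0] := leP r 0%R.
    rewrite beta0// (_ : _ @^-1` _ = set0) ?measure0//.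
    by apply/seteqP; split => // s /=; rewrite in_itv/= ltNge (le_trans r0).
  have [r1|r1] := ltP 1%R r.
    rewrite (_ : _ @^-1` _ = setT); last first.
      by apply/seteqP; split => // s _ /=; rewrite in_itv/= (le_lt_trans (q1 s)).
    rewrite abT; apply/eqP; rewrite eq_le; apply/andP; split; last first.
      by rewrite le_measure ?inE.
    by rewrite -(betaT 1%R)// le_measure ?inE//; exact: subset_itvl.
  (* As [q s] is an infimum, [q s < r] holds exactly when [F s] is at most the distribution function
     of [beta] at some r - 1/(n+1). The preimage is thus an increasing union of level sets of known
     mass. *)
  pose A n := [set s | F s <= beta `]-oo, (r - n.+1%:R^-1)%R]%classic].
  have mA n : measurable (A n : set (measurableTypeR R)).
    exact: measurable_cdf_level.
  have alphaA n : alpha (A n) = beta `]-oo, (r - n.+1%:R^-1)%R]%classic.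
    apply: atomless_cdf_level => //.
    by rewrite measure_ge0 abT/= le_measure ?inE.
  have qA : q @^-1` `]-oo, r[%classic = \bigcup_n A n.
    apply/seteqP; split => [s/=|s [n _]]; rewrite /= in_itv/=.
      move=> qr; have [t [t0 Ft] tr] := inf_lt (infS s).1 qr.
      have [n tn] := ltr_add_invr tr; exists n => //.
      by apply: (le_trans Ft); apply: beta_le; rewrite lerBrDr ltW.
    have [rn|rn] := leP 0%R (r - n.+1%:R^-1)%R => Fs.
      apply: (@le_lt_trans _ _ (r - n.+1%:R^-1)%R); last by rewrite gtrBl.
      by apply: ge_inf; [exact: (infS s).2|split].
    apply: le_lt_trans r0; apply: ge_inf; first exact: (infS s).2.
    by split => //; apply: (le_trans Fs); apply: beta_le; exact: ltW.
  have : alpha (A n) @[n --> \oo] --> alpha (\bigcup_n A n).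
    apply: (@nondecreasing_cvg_mu _ (measurableTypeR R) _ alpha) => //.
    - exact: bigcupT_measurable.
    - move=> i j ij; apply/subsetPset => s /le_trans; apply; apply: beta_le.
      by rewrite lerD2l lerN2 lef_pV2 ?posrE// ler_nat.
  rewrite -qA (eq_cvg _ _ alphaA) => /cvg_unique; apply => //.
  exact: cvg_cdf_left.
- move=> k; rewrite -ge0_fin_numE// /nu/= /pushforward fin_num_measure//.
  exact: mqV.
Qed.

End quantile_transport.

(** * Coding row vectors by reals, and transport to R^m *)

Section ternary_code.
Context d (T : measurableType d) (R : realType).
Implicit Types (A : nat -> set T) (n : nat) (v : T) (t : R).

(** Partial sums of a ternary expansion, unfolded from the leading digit. The digits are 0 and 2
    only, as in the Cantor set: values then lie in [0, 1/3] or [2/3, 1], so comparison with 1/2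
    reads off the leading digit without ambiguity. *)
Fixpoint pcode n A v : R :=
  if n is n'.+1 then (2 * \1_(A 0%N) v + pcode n' (fun k => A k.+1) v) / 3 else 0.

Definition code A v : R := lim (pcode n A v @[n --> \oo]).

Lemma pcode_itv n A v : 0 <= pcode n A v <= 1.
Proof.
elim: n A => [|n IH] A /=; first by rewrite lexx ler01.
have /andP[] := IH (fun k => A k.+1).
by rewrite indicE; case: (v \in A 0%N) => /=; lra.
Qed.

Lemma pcode_nd A v : nondecreasing_seq (fun n => pcode n A v).
Proof.
apply/nondecreasing_seqP => n; elim: n A => [|n IH] A /=.
  by have := pcode_itv 1 A v => /andP[].
by have /= := IH (fun k => A k.+1); lra.
Qed.

Lemma cvg_pcode A v : pcode n A v @[n --> \oo] --> code A v.
Proof.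
apply: nondecreasing_is_cvgn; first exact: pcode_nd.
by exists 1 => _ [n _ <-]; have /andP[] := pcode_itv n A v.
Qed.

Lemma code_itv A v : 0 <= code A v <= 1.
Proof.
apply/andP; split.
  apply: limr_ge; first exact: cvg_pcode.
  by apply: nearW => n; have /andP[] := pcode_itv n A v.
apply: limr_le; first exact: cvg_pcode.
by apply: nearW => n; have /andP[] := pcode_itv n A v.
Qed.

Lemma codeS A v : code A v = (2 * \1_(A 0%N) v + code (fun k => A k.+1) v) / 3.
Proof.
have := @cvg_pcode A v; rewrite -cvg_shiftS /= => /cvg_unique; apply => //.
by apply: cvgMl; apply: cvgD; [exact: cvg_cst|exact: cvg_pcode].
Qed.

Lemma measurable_code A : (forall n, measurable (A n)) -> measurable_fun setT (code A).
Proof.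
move=> mA; apply: (@measurable_fun_cvg _ _ _ _ (fun n => pcode n A)); last first.
  by move=> v _; exact: cvg_pcode.
move=> n; elim: n A mA => [|n IH] A mA /=; first exact: measurable_cst.
apply: measurable_funM => //; apply: measurable_funD; last exact: IH.
by apply: measurable_funM => //; exact: measurable_indic.
Qed.

(** On codes this deletes the leading digit; its values at other reals do not matter. *)
Definition digit_shift t : R := 3 * t - 2 * \1_`]1/2, +oo[ t.

Fixpoint digit n : set R :=
  if n is n'.+1 then digit_shift @^-1` (digit n') else `]1/2, +oo[.

Lemma measurable_digit n : measurable (digit n).
Proof.
elim: n => [|n IH] //=; rewrite -[X in measurable X]setTI.
suff : measurable_fun setT digit_shift by apply.
by apply: measurable_funB; apply: measurable_funM => //; exact: measurable_indic.
Qed.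

Lemma digit_code n A v : digit n (code A v) <-> A n v.
Proof.
elim: n A => [|n IH] A /=.
  rewrite in_itv/= andbT codeS indicE.
  have := code_itv (fun k => A k.+1) v => /andP[].
  by have [|] := boolP (v \in A 0%N); rewrite ?inE ?notin_setE /= => ? ? ?;
    split => // ?; try lra.
have <- := IH (fun k => A k.+1).
suff -> : digit_shift (code A v) = code (fun k => A k.+1) v by [].
rewrite /digit_shift codeS !indicE.
have := code_itv (fun k => A k.+1) v => /andP[].
case: (v \in A 0%N) => /= ? ?.
  by rewrite mem_set/=; [lra|rewrite in_itv/= andbT; lra].
by rewrite memNset/=; [lra|rewrite in_itv/= andbT; apply/negP; rewrite -leNgt; lra].
Qed.

End ternary_code.

(* A row vector is coded by the real in [0, 1] whose n-th ternary digit, 0 or 2,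
   tells whether the n-th rational half-space contains it; this reduces transport
   to R^m to transport to [0, 1]. *)
Section row_vector_code.
Context {R : realType} (m : nat).

Definition halfspace (n : nat) : set 'rV[R]_m :=
  if (unpickle n : option ('I_m * rat)) is Some (i, q) then [set v : 'rV[R]_m | v ord0 i < ratr q]
  else set0.

Lemma measurable_halfspace n : measurable (halfspace n).
Proof.
rewrite /halfspace; case: (unpickle n) => [[i q]|]//.
rewrite (_ : mkset _ = (fun v : 'rV[R]_m => v ord0 i) @^-1` `]-oo, ratr q[).
  by rewrite -[X in measurable X]setTI; exact: measurable_coord.
by apply/seteqP; split => v /=; rewrite in_itv.
Qed.

Definition rV_code (v : 'rV[R]_m) : measurableTypeR R := code R halfspace v.

(** A coordinate is the infimum of the rationals above it. Term [n] offers its rational when digit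
    [n] records membership in a half-space of coordinate [i], and otherwise +oo, which is neutral
    for the infimum. *)
Let decode_term (i : 'I_m) (n : nat) (t : R) : \bar R :=
  if (unpickle n : option ('I_m * rat)) is Some (j, q) then
    if j == i then (if t \in @digit R n then (ratr q)%:E else +oo%E) else +oo%E
  else +oo%E.

Definition rV_decode (t : measurableTypeR R) : 'rV[R]_m :=
  \row_i fine (einfs (decode_term i ^~ t) 0%N).

Lemma measurable_rV_decode : measurable_fun setT rV_decode.
Proof.
apply: measurable_fun_rVP => i.
rewrite (_ : (fun _ => _) = fine \o (fun t => einfs (decode_term i ^~ t) 0%N)).
  2: by apply/funext => t; rewrite mxE.
apply: measurableT_comp => //.
apply: (@measurable_fun_einfs _ (measurableTypeR R) R) => n.
rewrite /decode_term; case: (unpickle n) => [[j q]|]; last exact: measurable_cst.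
case: (j == i); last exact: measurable_cst.
apply: measurable_fun_if => //=.
apply: (measurable_fun_bool true).
rewrite setTI (_ : _ @^-1` _ = @digit R n); first exact: measurable_digit.
by apply/seteqP; split => t /= => [/set_mem|/mem_set].
Qed.

Lemma rV_codeK : cancel rV_code rV_decode.
Proof.
move=> v; apply/rowP => i; rewrite mxE.
suff -> : einfs (decode_term i ^~ (rV_code v)) 0%N = (v ord0 i)%:E by [].
apply/eqP; rewrite eq_le; apply/andP; split.
  apply/lee_addgt0Pr => e e0.
  have : v ord0 i < v ord0 i + e by rewrite ltrDl.
  move=> /rat_in_itvoo[q]; rewrite in_itv/= => /andP[vq qv].
  apply: (@le_trans _ _ (ratr q)%:E); last by rewrite -EFinD lee_fin ltW.
  apply: ereal_inf_lbound; exists (pickle (i, q)) => //.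
  rewrite /decode_term pickleK eqxx mem_set//.
  by rewrite /rV_code digit_code /halfspace pickleK.
apply: le_ereal_inf_tmp => _ [n _ <-]; rewrite /decode_term.
case E : unpickle => [[j q]|]; last by rewrite leey.
case: ifPn => [/eqP ji|]; last by rewrite leey.
case: ifPn; last by rewrite leey.
rewrite inE /rV_code digit_code /halfspace E /= ji lee_fin => /ltW//.
Qed.

End row_vector_code.

Section measure_upgrade.
Context d (T : measurableType d) (R : realType).
Local Open Scope ereal_scope.

(** The proof of finiteness is carried as an argument so that the structure of finite measure can be
    attached to the term; likewise for probabilities below. *)
Definition as_finite (mu : {measure set T -> \bar R}) (mu_fin : mu setT < +oo) :
  set T -> \bar R := mu.

Definition as_probability (mu : {measure set T -> \bar R}) (mu1 : mu setT = 1) :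
  set T -> \bar R := mu.

HB.instance Definition _ mu mu_fin :=
  Measure.copy (@as_finite mu mu_fin) mu.

HB.instance Definition _ mu mu_fin := @Measure_isFinite.Build _ _ _
  (@as_finite mu mu_fin) (lty_fin_num_fun mu_fin).

HB.instance Definition _ mu mu1 := Measure.copy (@as_probability mu mu1) mu.

HB.instance Definition _ mu mu1 := @Measure_isProbability.Build _ _ _
  (@as_probability mu mu1) mu1.

End measure_upgrade.

Section transport.
Context {R : realType} (m : nat).
Local Open Scope ereal_scope.

(** The target is coded into [0, 1], reached there by the quantile map, and decoded. Decoding is a
    measurable left inverse defined on all reals, so no isomorphism onto the range of the code has
    to be constructed. *)
Lemma atomless_transport (alpha : {finite_measure set (measurableTypeR R) -> \bar R})
    (mu : {measure set 'rV[R]_m -> \bar R}) :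
  (forall s, alpha [set s] = 0) -> alpha setT = mu setT ->
  exists2 S : measurableTypeR R -> 'rV[R]_m, measurable_fun setT S &
    forall B, measurable B -> alpha (S @^-1` B) = mu B.
Proof.
move=> alpha1 amT.
have mc : measurable_fun setT (@rV_code R m).
  by apply: measurable_code; exact: measurable_halfspace.
have md := @measurable_rV_decode R m.
pose b := measure_function_pushforward__canonical__measure_function_Measure mu mc.
have bfin : b setT < +oo.
  by rewrite /b/= /pushforward preimage_setT -amT -ge0_fin_numE// fin_num_measure.
pose beta : {finite_measure set (measurableTypeR R) -> \bar R} := as_finite bfin.
have b01 : beta (~` `[0%R, 1%R]%classic) = 0.
  rewrite /beta/= /pushforward (_ : _ @^-1` _ = set0) ?measure0//.
  apply/seteqP; split => // v /=; rewrite in_itv/=; apply.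
  exact: code_itv.
have abT : alpha setT = beta setT by rewrite /beta/= /pushforward preimage_setT.
have [q mq qE] := quantile_transport alpha1 b01 abT.
exists (@rV_decode R m \o q); first exact: measurableT_comp.
move=> B mB; have mdB : measurable (@rV_decode R m @^-1` B).
  by rewrite -[X in measurable X]setTI; exact: md.
rewrite comp_preimage qE// /beta/= /pushforward -comp_preimage.
congr (mu _); apply/seteqP; split => v; rewrite /= rV_codeK//.
Qed.

End transport.

(** * Couplings with an empirical measure *)

Section norm1_theory.
Context {R : realType} (m : nat).
Implicit Types u v w : 'rV[R]_m.

Lemma norm1_ge0 u : 0 <= norm1 u.
Proof. exact: sumr_ge0. Qed.

Lemma norm1N u : norm1 (- u) = norm1 u.
Proof. by apply: eq_bigr => i _; rewrite mxE normrN. Qed.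

Lemma norm1C u v : norm1 (u - v) = norm1 (v - u).
Proof. by rewrite -norm1N opprB. Qed.

Lemma norm1D u v : norm1 (u + v) <= norm1 u + norm1 v.
Proof.
by rewrite /norm1 -big_split ler_sum//= => i _; rewrite mxE ler_normD.
Qed.

Lemma norm1_tri u v w : norm1 (u - w) <= norm1 (u - v) + norm1 (v - w).
Proof. by rewrite (le_trans _ (norm1D _ _))// addrA subrK. Qed.

Lemma measurable_norm1 d (T : measurableType d) (f : T -> 'rV[R]_m) :
  measurable_fun setT f -> measurable_fun setT (fun t => norm1 (f t)).
Proof.
move=> mf; rewrite (_ : (fun _ => _) = \sum_(i < m) (fun t => `|f t ord0 i|)).
  2: by apply/funext => t; rewrite fct_sumE.
elim/big_ind : _ => [|g h mg mh|j _]; first exact: measurable_cst.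
  exact: measurable_funD.
apply: measurableT_comp => //.
exact: (measurableT_comp (measurable_coord j) mf).
Qed.

Lemma measurable_rVB d (T : measurableType d) (f g : T -> 'rV[R]_m) :
  measurable_fun setT f -> measurable_fun setT g ->
  measurable_fun setT (fun t => f t - g t).
Proof.
move=> mf mg; apply: measurable_fun_rVP => i.
rewrite (_ : (fun _ => _) = fun t => f t ord0 i - g t ord0 i).
  2: by apply/funext => t; rewrite !mxE.
apply: measurable_funB.
  exact: (measurableT_comp (measurable_coord i) mf).
exact: (measurableT_comp (measurable_coord i) mg).
Qed.

Lemma measurable_rV1 v : measurable [set v].
Proof.
rewrite (_ : [set v] = \bigcap_(i in [set: 'I_m])
    ((fun u : 'rV[R]_m => u ord0 i) @^-1` [set v ord0 i])); last first.
  apply/seteqP; split => [_ -> //|u uv]; apply/rowP => i; exact: uv.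
apply: fin_bigcap_measurable => // i _.
by rewrite -[X in measurable X]setTI; exact: measurable_coord.
Qed.

End norm1_theory.

Section measure_fsum.
Context d (T : measurableType d) (R : realType) (N : nat).
Variable mu_ : 'I_N -> {measure set T -> \bar R}.
Local Open Scope ereal_scope.

Definition fsum_measure : {measure set T -> \bar R} :=
  msum (fun n => if insub n is Some k then mu_ k else mzero) N.

Lemma fsum_measureE A : fsum_measure A = \sum_(k < N) mu_ k A.
Proof. by apply: eq_bigr => k _; rewrite valK. Qed.

Lemma ge0_integral_fsum (mu : {measure set T -> \bar R}) (f : T -> \bar R) :
  (forall A, measurable A -> mu A = \sum_(k < N) mu_ k A) ->
  measurable_fun setT f -> (forall x, 0 <= f x) ->
  \int[mu]_x f x = \sum_(k < N) \int[mu_ k]_x f x.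
Proof.
move=> muE mf f0; rewrite (@ge0_integral_lincomb _ _ _ N (fun=> 1%R) mu_)//.
  by apply: eq_bigr => k _; rewrite mul1e.
by move=> A mA; rewrite muE//; apply: eq_bigr => k _; rewrite mul1e.
Qed.

End measure_fsum.

Section split_couplings.
Context {R : realType} (m N : nat) (P : probability 'rV[R]_m R).
Local Open Scope ereal_scope.
Implicit Types (x : 'I_N -> 'rV[R]_m) (nu : 'I_N -> {measure set 'rV[R]_m -> \bar R}).

(** A coupling with an empirical measure, disintegrated over the sample: N times [nu k] is the law
    of the first component given the k-th sample point. The index is the sample number and not the
    location, so a split does not mention the sample. *)
Definition is_split nu : Prop :=
  (forall k, nu k setT = (N%:R^-1)%:E) /\
  (forall A, measurable A -> P A = \sum_(k < N) nu k A).

Definition split_cost x nu : \bar R :=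
  \sum_(k < N) \int[nu k]_y (norm1 (y - x k))%:E.

Let mnorm x k : measurable_fun setT (fun y : 'rV[R]_m => (norm1 (y - x k))%:E).
Proof.
apply/measurable_EFinP; apply: measurable_norm1; apply: measurable_rVB => //.
Qed.

Lemma split_cost_le x x' nu : is_split nu ->
  split_cost x' nu <=
  split_cost x nu + (N%:R^-1 * \sum_(k < N) norm1 (x k - x' k)%R)%:E.
Proof.
move=> [nuT _].
rewrite mulr_sumr -sumEFin -big_split /=; apply: lee_sum => k _.
rewrite EFinM muleC -(nuT k) -integral_cst//= -ge0_integralD//=; last 2 first.
- by move=> y _; rewrite lee_fin norm1_ge0.
- by move=> y _; rewrite lee_fin norm1_ge0.
apply: ge0_le_integral => //.
- by move=> y _; rewrite lee_fin norm1_ge0.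
- by apply: emeasurable_funD; [exact: mnorm|exact: measurable_cst].
- by move=> y _; rewrite -EFinD lee_fin norm1_tri.
Qed.

(** The pieces are reassembled into a coupling as the sum over [k] of the images of [nu k] under
    [y |-> (y, x k)]. *)
Lemma wasserstein_split x nu : is_split nu ->
  wasserstein P (empirical x) <= split_cost x nu.
Proof.
move=> [nuT nuP].
pose J k (y : 'rV[R]_m) := (y, x k).
have mJ k : measurable_fun setT (J k) by exact: measurable_fun_pair.
pose pi_ k : {measure set ('rV[R]_m * 'rV[R]_m)%type -> \bar R} :=
  measure_function_pushforward__canonical__measure_function_Measure (nu k) (mJ k).
pose pi0 := fsum_measure pi_.
have pi1 : pi0 setT = 1.
  rewrite /pi0 fsum_measureE -(probability_setT P) nuP//.
pose pi : probability _ R := as_probability pi1.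
apply: ge_ereal_inf; exists (\int[pi]_z (norm1 (z.1 - z.2))%:E).
  exists pi => // A mA; split.
    rewrite /pushforward [LHS]fsum_measureE nuP//.
  rewrite /pushforward [LHS]fsum_measureE /empirical /mixture.
  rewrite ge0_sume_distrr//; apply: eq_bigr => k _.
  rewrite /pi_/= /pushforward/= diracE.
  have [xA|xA] := boolP (x k \in A).
    rewrite mule1 -(nuT k); congr (nu k _); apply/seteqP; split => // y _ /=.
    exact: set_mem.
  rewrite mule0 -(measure0 (nu k)); congr (nu k _); apply/seteqP; split => // y /=.
  by move/mem_set; rewrite (negbTE xA).
have mN : measurable_fun setT (fun z : 'rV[R]_m * 'rV[R]_m => (norm1 (z.1 - z.2))%:E).
  apply/measurable_EFinP; apply: measurable_norm1.
  by apply: measurable_rVB; [exact: measurable_fst|exact: measurable_snd].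
rewrite (@ge0_integral_fsum _ _ _ _ pi_)//; last 2 first.
- by move=> A mA; exact: fsum_measureE.
- by move=> z; rewrite lee_fin norm1_ge0.
apply: lee_sum => k _.
rewrite ge0_integral_pushforward//= => z _; by rewrite lee_fin norm1_ge0.
Qed.

End split_couplings.

Lemma ge0_integral_mrestr d (T : measurableType d) (R : realType)
    (mu : {measure set T -> \bar R}) (D : set T) (mD : measurable D) (f : T -> \bar R) :
  measurable_fun setT f -> (forall t, 0 <= f t)%E ->
  (\int[mrestr mu mD]_t f t = \int[mu]_(t in D) f t)%E.
Proof.
move=> mf f0; rewrite (@ge0_negligible_integral _ _ _ _ setT (~` D))//.
- rewrite setTD setCK; apply: eq_measure_integral => A mA AD.
  by rewrite /= /mrestr setIidl.
- exact: measurableC.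
- by rewrite /= /mrestr setICl measure0.
Qed.

Section coupling_split.
Context {R : realType} (m N : nat) (P : probability 'rV[R]_m R).
Local Open Scope ereal_scope.
Implicit Types (x : 'I_N -> 'rV[R]_m).

Lemma empirical_set1 x (v : 'rV[R]_m) :
  empirical x [set v] = (N%:R^-1 * #|[pred j | x j == v]|%:R)%:E.
Proof.
rewrite /empirical /mixture EFinM; congr (_ * _).
rewrite -sum1_card natr_sum -sumEFin [RHS]big_mkcond/=; apply: eq_bigr => j _.
rewrite diracE inE; have [->|xv] := eqVneq (x j) v; first by rewrite mem_set.
by rewrite memNset//= => xv'; rewrite xv' eqxx in xv.
Qed.

(** The second marginal lives on finitely many points, so conditioning on it is just restriction of
    [pi] to the fibres [D k]. *)
Lemma coupling_split x (pi : probability ('rV[R]_m * 'rV[R]_m)%type R) :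
  couplings P (empirical x) pi ->
  exists2 nu, is_split P nu & split_cost x nu <= \int[pi]_z (norm1 (z.1 - z.2))%:E.
Proof.
move=> cpi.
(* Sample points may coincide, and then share equally the mass coupled with
   their common value. *)
pose mult k := #|[pred j | x j == x k]|.
have mult_gt0 k : (0 < mult k)%N.
  by apply/card_gt0P; exists k; rewrite inE.
have c0 k : (0 <= (mult k)%:R^-1 :> R)%R by rewrite invr_ge0.
pose D k : set ('rV[R]_m * 'rV[R]_m) := snd @^-1` [set x k].
have mD k : measurable (D k).
  by rewrite -[X in measurable X]setTI; apply: measurable_snd => //; exact: measurable_rV1.
have m1 : measurable_fun setT (fst : 'rV[R]_m * 'rV[R]_m -> 'rV[R]_m).
  exact: measurable_fst.
pose nu k : {measure set 'rV[R]_m -> \bar R} := mscale (NngNum (c0 k))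
  (measure_function_pushforward__canonical__measure_function_Measure
    (mrestr pi (mD k)) m1).
have nuE k A : nu k A = ((mult k)%:R^-1)%:E * pi (fst @^-1` A `&` D k) by [].
pose w (z : 'rV[R]_m * 'rV[R]_m) : R :=
  (\sum_(k < N) (mult k)%:R^-1 * \1_(D k) z)%R.
(* Over the value [x j] exactly [mult j] indices are active, each with weight 1 / [mult j]; outside
   the range of [x] the second marginal has no mass. Inserting the factor [w] therefore cuts any
   integral into the contributions of the fibres. *)
have w1 : {ae pi, forall z, w z = 1%R}.
  pose E := snd @^-1` (~` range x) : set ('rV[R]_m * 'rV[R]_m).
  have mr : measurable (~` range x).
    apply: measurableC; rewrite (_ : range x = \bigcup_k [set x k]); last first.
      by apply/seteqP; split => v [k _]; [move=> <-; exists k|move=> ->; exists k].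
    by apply: fin_bigcup_measurable => // k _; exact: measurable_rV1.
  exists E; split.
  - by rewrite -[X in measurable X]setTI; exact: measurable_snd.
  - have [_] := cpi _ mr; rewrite /pushforward => ->.
    rewrite /empirical /mixture big1 ?mule0// => k _.
    by rewrite /= diracE memNset// => -[]; exists k.
  - move=> z /=; apply: contra_not => -[j _ xz]; rewrite /w.
    rewrite (eq_bigr (fun k => if x k == x j then (mult j)%:R^-1 else 0)%R).
      rewrite -big_mkcond sumr_const -(_ : mult j = #|[pred k | x k == x j]|)//.
      by rewrite -[LHS]mulr_natr mulVf// pnatr_eq0 -lt0n.
    move=> k _; rewrite indicE; case: eqVneq => [xkj|xkj].
      rewrite mem_set ?mulr1; last by rewrite /D/= xkj.
      by rewrite /mult xkj.
    by rewrite memNset ?mulr0//= /D/= -xz => xkj'; rewrite xkj' eqxx in xkj.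
have key (g : 'rV[R]_m * 'rV[R]_m -> \bar R) :
    measurable_fun setT g -> (forall z, 0 <= g z) ->
    \int[pi]_z g z = \sum_(k < N) ((mult k)%:R^-1)%:E * \int[pi]_(z in D k) g z.
  move=> mg g0.
  rewrite (@ge0_ae_eq_integral _ _ _ pi setT g (fun z => (w z)%:E * g z))//; last 3 first.
  - apply: emeasurable_funM => //; apply/measurable_EFinP.
    rewrite (_ : w = (\sum_(k < N) (fun z => (mult k)%:R^-1 * \1_(D k) z))%R).
      elim/big_ind : _ => [|f h mf mh|k _]; first exact: measurable_cst.
        exact: measurable_funD.
      by apply: measurable_funM => //; exact: measurable_indic.
    by apply/funext => z; rewrite fct_sumE.
  - by move=> z _; rewrite mule_ge0// lee_fin sumr_ge0// => k _; rewrite mulr_ge0.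
  - by apply: filterS w1 => z /= + _ => ->; rewrite mul1e.
  rewrite (eq_integral (fun z => \sum_(k < N) ((mult k)%:R^-1)%:E * (g \_ (D k)) z)); last first.
    move=> z _; rewrite /w -sumEFin ge0_sume_distrl; last first.
      by move=> k _; rewrite lee_fin mulr_ge0.
    apply: eq_bigr => k _; rewrite EFinM -muleA; congr (_ * _).
    by rewrite patchE indicE; case: ifPn; rewrite ?mul1e ?mul0e.
  rewrite ge0_integral_sum//; last 2 first.
  - move=> k; apply: emeasurable_funM => //; apply/(measurable_restrictT _ _).1 => //.
    exact: measurable_funTS.
  - by move=> k z _; rewrite mule_ge0 ?lee_fin// patchE; case: ifP.
  apply: eq_bigr => k _; rewrite ge0_integralZl_EFin//; last 2 first.
  - by move=> z _; rewrite patchE; case: ifP.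
  - by apply/(measurable_restrictT _ _).1 => //; exact: measurable_funTS.
  by rewrite -integral_mkcond.
have fstV A : measurable A -> measurable (fst @^-1` A : set ('rV[R]_m * 'rV[R]_m)).
  by move=> mA; rewrite -[X in measurable X]setTI; exact: measurable_fst.
exists nu.
  split.
    move=> k; rewrite nuE preimage_setT setTI.
    have [_] := cpi _ (measurable_rV1 (x k)); rewrite /pushforward -/(D k) => ->.
    by rewrite empirical_set1 -EFinM mulrCA mulVf ?mulr1// pnatr_eq0 -lt0n.
  move=> A mA; have [<- _] := cpi _ mA; rewrite /pushforward.
  rewrite (_ : pi (fst @^-1` A) = \int[pi]_(z in fst @^-1` A) cst 1 z); last first.
    by rewrite integral_cst ?mul1e//; exact: fstV.
  rewrite integral_mkcond key; last 2 first.
  - by apply/(measurable_restrictT _ _).1 => //; exact: fstV.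
  - by move=> z; rewrite patchE; case: ifP.
  apply: eq_bigr => k _; rewrite nuE; congr (_ * _).
  rewrite -integral_mkcondl integral_cst ?mul1e//.
  by apply: measurableI => //; exact: fstV.
have mN : measurable_fun setT (fun z : 'rV[R]_m * 'rV[R]_m => (norm1 (z.1 - z.2))%:E).
  apply/measurable_EFinP; apply: measurable_norm1.
  by apply: measurable_rVB; [exact: measurable_fst|exact: measurable_snd].
rewrite key//; last by move=> z; rewrite lee_fin norm1_ge0.
apply: lee_sum => k _.
have mk : measurable_fun setT (fun y : 'rV[R]_m => (norm1 (y - x k))%:E).
  by apply/measurable_EFinP; apply: measurable_norm1; exact: measurable_rVB.
have nn (y : 'rV[R]_m) : 0 <= (norm1 y)%:E by rewrite lee_fin norm1_ge0.
rewrite ge0_integral_mscale// ge0_integral_pushforward//=.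
rewrite preimage_setT ge0_integral_mrestr//; last exact: (measurableT_comp mk m1).
rewrite lee_pmul2l ?lte_fin ?invr_gt0 ?ltr0n//.
rewrite le_eqVlt; apply/orP; left; apply/eqP; apply: eq_integral => z.
by rewrite inE => ->.
Qed.

End coupling_split.

(** * Measurability of Wasserstein balls in the sample *)

Section wasserstein_measurable.
Context {R : realType} (m N : nat) (P : probability 'rV[R]_m R).
Local Open Scope ereal_scope.
Implicit Types (x : 'I_N -> 'rV[R]_m).

Definition mean_dist x x' : R := (N%:R^-1 * \sum_(k < N) norm1 (x k - x' k))%R.

Lemma mean_distC x x' : mean_dist x x' = mean_dist x' x.
Proof. by congr (_ * _)%R; apply: eq_bigr => k _; rewrite norm1C. Qed.

(** A split extracted for [x] is also a split for [x'], and each of its pieces has mass 1/N, so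
    moving the sample changes the cost by at most the mean displacement. *)
Lemma wasserstein_empirical_lip x x' :
  wasserstein P (empirical x') <=
  wasserstein P (empirical x) + (mean_dist x x')%:E.
Proof.
rewrite -leeBlDr//; apply: le_ereal_inf_tmp => _ [pi cpi <-].
rewrite leeBlDr//; have [nu snu cost_nu] := coupling_split cpi.
apply: (le_trans (wasserstein_split x' snu)).
apply: (le_trans (split_cost_le x x' snu)).
by rewrite leeD2r.
Qed.

Let point (q : {ffun 'I_N * 'I_m -> rat}) (k : 'I_N) : 'rV[R]_m :=
  (\row_i ratr (q (k, i)))%R.

Let dense_point x (e : R) : (0 < e)%R -> exists q, (mean_dist x (point q) <= e)%R.
Proof.
move=> e0.
have h (k : 'I_N) (i : 'I_m) : exists q : rat, (`|x k ord0 i - ratr q| <= e / m%:R)%R.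
  have em : (0 < e / m%:R)%R by rewrite divr_gt0// ltr0n (leq_trans _ (ltn_ord i)).
  have : (x k ord0 i < x k ord0 i + e / m%:R)%R by rewrite ltrDl.
  move=> /rat_in_itvoo[q]; rewrite in_itv/= => /andP[q1 q2]; exists q.
  by rewrite distrC ger0_norm ?subr_ge0 1?ltW// ltrBlDl.
have /choice[q qP] : forall ki : 'I_N * 'I_m, exists q : rat,
    (`|x ki.1 ord0 ki.2 - ratr q| <= e / m%:R)%R by case.
exists [ffun ki => q ki]; rewrite /mean_dist.
have [N0|N0] := posnP N.
  by rewrite [X in X%:R^-1%R]N0 invr0 mul0r ltW.
rewrite ler_pdivrMl ?ltr0n//.
rewrite (_ : (N%:R * e = \sum_(k < N) e)%R); last first.
  by rewrite sumr_const card_ord mulr_natl.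
apply: ler_sum => k _.
have [m0|m0] := posnP m.
  by rewrite /norm1 big1 ?ltW// => i; have := ltn_ord i; rewrite [X in (_ < X)%N -> _]m0.
rewrite (_ : (e = \sum_(i < m) (e / m%:R))%R); last first.
  by rewrite sumr_const card_ord -[RHS]mulr_natr divfK// pnatr_eq0 -lt0n.
by apply: ler_sum => i _; rewrite !mxE ffunE (qP (k, i)).
Qed.

(** By the Lipschitz bound the distance is the infimum over rational samples [q] of its value at [q]
    plus the mean distance to [q]. Its sublevel sets thus involve countably many functions that are
    measurable in the sample. *)
Lemma measurable_wasserstein_ball d (Omega : measurableType d)
    (y : 'I_N -> Omega -> 'rV[R]_m) (e : R) :
  (forall k, measurable_fun setT (y k)) ->
  measurable [set omega | wasserstein P (empirical (y ^~ omega)) <= e%:E].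
Proof.
move=> my; pose W x := wasserstein P (empirical x).
rewrite (_ : mkset _ = \bigcap_n \bigcup_q [set omega |
    W (point q) + (mean_dist (y ^~ omega) (point q))%:E <= (e + n.+1%:R^-1)%:E]).
  apply: bigcapT_measurable => n; apply: countable_bigcupT_measurable.
    exact: countableP.
  move=> q; rewrite -[X in measurable X]setTI.
  apply: emeasurable_fun_infty_c => //; apply: emeasurable_funD => //.
  apply/measurable_EFinP; apply: measurable_funM => //.
  rewrite (_ : (fun _ => _) =
    (\sum_(k < N) (fun omega => norm1 (y k omega - point q k)))%R); last first.
    by apply/funext => omega; rewrite fct_sumE.
  elim/big_ind : _ => [|f g mf mg|k _]; first exact: measurable_cst.
    exact: measurable_funD.
  by apply: measurable_norm1; apply: measurable_rVB.
apply/seteqP; split => omega.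
  move=> We n _; have n0 : (0 < n.+1%:R^-1 / 2 :> R)%R by rewrite divr_gt0 ?invr_gt0.
  have [q dq] := dense_point (y ^~ omega) n0; exists q => //=.
  apply: (@le_trans _ _ (W (y ^~ omega) + (n.+1%:R^-1 / 2)%:E + (n.+1%:R^-1 / 2)%:E)).
    apply: leeD; last by rewrite lee_fin.
    by apply: (le_trans (wasserstein_empirical_lip (y ^~ omega) _)); rewrite leeD2l.
  by rewrite -addeA -EFinD -splitr EFinD leeD2r.
move=> h; apply/lee_addgt0Pr => r r0.
have [n nr] : exists n, (n.+1%:R^-1 < r)%R.
  by have /ltr_add_invr[n] := r0; rewrite add0r => nr; exists n.
have [q _ /= hq] := h n Logic.I.
apply: (le_trans (wasserstein_empirical_lip (point q) _)).
rewrite mean_distC; apply: (le_trans hq).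
by rewrite -EFinD lee_fin lerD2l ltW.
Qed.

End wasserstein_measurable.

(** * Near-optimal maps from the Gaussian mixture *)

Section piecewise.
Context d (T : measurableType d) (N : nat).
Variables (U : 'I_N -> set T) (J : T -> 'I_N).
Hypothesis mU : forall j, measurable (U j).
Hypothesis UJ : forall t j, U j t <-> J t = j.

Lemma measurable_piecewise d' (T' : measurableType d') (F : 'I_N -> T -> T') :
  (forall j, measurable_fun setT (F j)) ->
  measurable_fun setT (fun t => F (J t) t).
Proof.
move=> mF _ B mB; rewrite setTI.
rewrite (_ : _ @^-1` _ = \bigcup_(j in [set: 'I_N]) (U j `&` F j @^-1` B)).
  apply: fin_bigcup_measurable => // j _; apply: measurableI => //.
  by rewrite -[X in measurable X]setTI; exact: mF.
apply/seteqP; split => t /= => [FB|[j _ [/UJ <-]]//].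
by exists (J t) => //; split => //; exact/UJ.
Qed.

End piecewise.

Section finite_partition.
Context d (T : measurableType d) (R : realType) (N : nat).
Variables (mu : {measure set T -> \bar R}) (U : 'I_N -> set T) (J : T -> 'I_N).
Hypothesis mU : forall j, measurable (U j).
Hypothesis UJ : forall t j, U j t <-> J t = j.
Local Open Scope ereal_scope.

Lemma measure_partition A : measurable A ->
  mu A = \sum_(j < N) mu (A `&` U j).
Proof.
move=> mA; rewrite -(@measure_bigsetU_ord _ _ _ mu N xpredT (fun j => A `&` U j)).
- congr (mu _); rewrite -bigcup_seq; apply/seteqP; split => t.
    by move=> At; exists (J t); [rewrite /= mem_index_enum|split => //; exact/UJ].
  by move=> [j _ []].
- by move=> j; exact: measurableI.
- apply/trivIsetP => i j _ _ ij; apply/seteqP; split => // t.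
  by move=> [[_ /UJ Ji] [_ /UJ Jj]]; move: ij; rewrite -Ji Jj eqxx.
Qed.

Lemma integral_partition (f : T -> \bar R) :
  measurable_fun setT f -> (forall t, 0 <= f t) ->
  \int[mu]_t f t = \sum_(j < N) \int[mu]_(t in U j) f t.
Proof.
move=> mf f0; rewrite (@ge0_integral_fsum _ _ _ _ (fun j => mrestr mu (mU j)))//.
  by apply: eq_bigr => j _; rewrite ge0_integral_mrestr.
by move=> A mA; rewrite measure_partition.
Qed.

End finite_partition.

Section voronoi.
Context {R : realType} (m N : nat) (x : 'I_N -> 'rV[R]_m).

(** Ties go to the least index, so the cells form a genuine partition even when sample points
    coincide. *)
Definition voronoi (j : 'I_N) : set 'rV[R]_m := [set v |
  (forall i, norm1 (v - x j) <= norm1 (v - x i)) /\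
  (forall i : 'I_N, (i < j)%N -> norm1 (v - x j) < norm1 (v - x i))].

Let mnorm (k : 'I_N) : measurable_fun setT (fun v : 'rV[R]_m => norm1 (v - x k)).
Proof. by apply: measurable_norm1; exact: measurable_rVB. Qed.

Lemma measurable_voronoi j : measurable (voronoi j).
Proof.
rewrite (_ : voronoi j =
    (\bigcap_(i in [set: 'I_N]) [set v | norm1 (v - x j) <= norm1 (v - x i)]) `&`
    (\bigcap_(i in [set i : 'I_N | (i < j)%N]) [set v | norm1 (v - x j) < norm1 (v - x i)])).
  apply: measurableI; apply: fin_bigcap_measurable => // i _.
    by rewrite -[X in measurable X]setTI; exact: measurable_fun_ler.
  by rewrite -[X in measurable X]setTI; exact: measurable_fun_ltr.
by apply/seteqP; split => v [v1 v2]; split => i;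
  [move=> _; exact: v1|exact: v2|exact: v1|move=> ij; exact: v2].
Qed.

Lemma voronoi_index : (0 < N)%N ->
  exists J : 'rV[R]_m -> 'I_N, forall v j, voronoi j v <-> J v = j.
Proof.
move=> N0; suff : forall v, exists j, voronoi j v.
  move=> /choice[J JP]; exists J => v j; split => [[v1 v2]|<-//].
  have [w1 w2] := JP v; apply/val_inj/eqP; case: ltngtP => // ij.
    by have := v2 _ ij; rewrite ltNge w1.
  by have := w2 _ ij; rewrite ltNge v1.
move=> v; pose j0 := Ordinal N0.
pose i0 := [arg min_(i < j0) norm1 (v - x i)]%O.
have i0P i : norm1 (v - x i0) <= norm1 (v - x i).
  by rewrite /i0; case: Order.TotalTheory.arg_minP => // k _; exact.
pose Q (i : 'I_N) := norm1 (v - x i) == norm1 (v - x i0).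
have Qi0 : Q i0 by rewrite /Q.
pose j := [arg min_(i < i0 | Q i) (i : nat)]%N.
exists j; rewrite /j; case: arg_minnP => // k /eqP kE kmin; split => i.
  by rewrite kE.
move=> ik; rewrite lt_neqAle kE i0P andbT eq_sym; apply/negP => Qi.
by have := kmin i Qi; rewrite leqNgt ik.
Qed.

End voronoi.

Section voronoi_gaussian.
Context {R : realType} (m N : nat) (x : 'I_N -> 'rV[R]_m.+1) (J : 'rV[R]_m.+1 -> 'I_N).
Hypothesis UJ : forall v j, voronoi x j v <-> J v = j.
Local Open Scope ereal_scope.

Lemma norm1_axis (t : R) : norm1 (axis m t) = `|t|%R.
Proof.
rewrite /norm1 (bigD1 ord0)//= axisE eqxx mulr1 big1 ?addr0// => i /negbTE i0.
by rewrite axisE i0 mulr0 normr0.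
Qed.

Lemma norm1_axis_line k (t : R) : norm1 (x k + axis m t - x k) = `|t|%R.
Proof. by rewrite addrAC subrr add0r norm1_axis. Qed.

Lemma voronoi_min v k : (norm1 (v - x (J v)) <= norm1 (v - x k))%R.
Proof. by have [+ _] := (UJ v (J v)).2 erefl; exact. Qed.

Lemma measurable_voronoi_dist : measurable_fun setT (fun v : 'rV[R]_m.+1 => (norm1 (v - x (J v)))%:E).
Proof.
apply/measurable_EFinP; apply: measurable_norm1; apply: measurable_rVB => //.
apply: (measurable_piecewise (measurable_voronoi x) UJ (F := fun j => cst (x j))) => j.
exact: measurable_cst.
Qed.

Lemma sum_mean (a : \bar R) : (0 < N)%N -> \sum_(k < N) (N%:R^-1)%:E * a = a.
Proof.
move=> N0; rewrite -ge0_sume_distrl; last by move=> k _; rewrite lee_fin invr_ge0.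
rewrite sumEFin sumr_const card_ord -[X in X%:E]mulr_natl mulfV ?mul1e//.
by rewrite pnatr_eq0 -lt0n.
Qed.

Lemma integral_voronoi_dist (s : R) : (0 < N)%N -> (0 <= s)%R ->
  \int[gaussian_mixture x (axis_cov m s)]_v (norm1 (v - x (J v)))%:E <=
  \int[normal_prob 0 1]_(t in [set: measurableTypeR R]) (`|t * s|)%:E.
Proof.
move=> N0 s0; rewrite integral_gaussian_mixture_axis//; last 2 first.
- exact: measurable_voronoi_dist.
- by move=> v; rewrite lee_fin norm1_ge0.
rewrite -[leRHS]sum_mean//; apply: lee_sum => k _.
rewrite lee_pmul2l ?lte_fin ?invr_gt0 ?ltr0n//; apply: ge0_le_integral => //.
- by move=> t _; rewrite lee_fin norm1_ge0.
- exact: (measurableT_comp measurable_voronoi_dist (@measurable_axis_line _ _ (x k) s)).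
- by apply/measurable_EFinP; apply: measurableT_comp => //; exact: measurable_funM.
- by move=> t _; rewrite lee_fin -(norm1_axis_line k) voronoi_min.
Qed.

End voronoi_gaussian.

Section near_optimal_map.
Context {R : realType} (m N : nat) (P : probability 'rV[R]_m.+1 R).
Variables (x : 'I_N -> 'rV[R]_m.+1) (nu : 'I_N -> {measure set 'rV[R]_m.+1 -> \bar R}).
Variable s : R.
Hypotheses (N0 : (0 < N)%N) (s0 : 0 < s) (snu : is_split P nu).
Local Open Scope ereal_scope.

Let gam : probability (measurableTypeR R) R := normal_prob 0%R 1%R.

Lemma normal_prob_set1 (t : R) : normal_prob 0 1 ([set t] : set (measurableTypeR R)) = 0.
Proof.
have /null_content_dominatesP := @normal_prob_dominates R 0 1; apply => //.
exact: lebesgue_measure_set1.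
Qed.

Let G : {measure set 'rV[R]_m.+1 -> \bar R} := gaussian_mixture x (axis_cov m s).
Let L k (t : measurableTypeR R) : 'rV[R]_m.+1 := (x k + axis m (t * s))%R.
Let U := voronoi x.

Let mL k : measurable_fun setT (L k). Proof. exact: measurable_axis_line. Qed.

Let mLV k A : measurable A -> measurable (L k @^-1` A).
Proof. by move=> mA; rewrite -[X in measurable X]setTI; exact: mL. Qed.

Let mU j : measurable (U j). Proof. exact: measurable_voronoi. Qed.

Let GE A : measurable A -> G A = \sum_(k < N) (N%:R^-1)%:E * gam (L k @^-1` A).
Proof. by move=> mA; apply: gaussian_mixture_axis => //; exact: ltW. Qed.

Let first_coord (v : 'rV[R]_m.+1) : measurableTypeR R := v ord0 ord0.

Let mfc : measurable_fun setT first_coord. Proof. exact: measurable_coord. Qed.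

Let gam_lt_pinfty A : measurable A -> gam A < +oo.
Proof. by move=> mA; rewrite (le_lt_trans (probability_le1 _ mA)) ?ltry. Qed.

Let law j : {measure set (measurableTypeR R) -> \bar R} :=
  measure_function_pushforward__canonical__measure_function_Measure
    (mrestr G (mU j)) mfc.

Let lawE j B : law j B = G (first_coord @^-1` B `&` U j). Proof. by []. Qed.

Let c k j : R := fine (gam (L k @^-1` U j)).

Let cE k j : (c k j)%:E = gam (L k @^-1` U j).
Proof. by rewrite fineK// fin_num_measure//; exact: mLV. Qed.

Let c0 k j : (0 <= c k j)%R. Proof. exact: fine_ge0. Qed.

(** What cell [j] must be sent to: [c k j] is the probability that component [k] falls into cell
    [j], and the same fraction of [nu k] is assigned to that cell. Masses match because [nu k] has
    mass 1/N, and the targets add up to [P] because the [c k j] sum to 1 over [j]. *)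
Let target j : {measure set 'rV[R]_m.+1 -> \bar R} :=
  fsum_measure (fun k => mscale (NngNum (c0 k j)) (nu k)).

Let targetE j B : target j B = \sum_(k < N) (c k j)%:E * nu k B.
Proof. by rewrite [LHS]fsum_measureE. Qed.

Let law_lt_pinfty j : law j setT < +oo.
Proof.
rewrite lawE preimage_setT setTI GE//; apply/lte_sum_pinfty => k _.
by rewrite lte_mul_pinfty ?lee_fin ?invr_ge0// gam_lt_pinfty//; exact: mLV.
Qed.

(** Since [s > 0], each line takes the first coordinate [r] at a single parameter [t], and the
    normal law has no atoms. *)
Let law_set1 j r : as_finite (law_lt_pinfty j) [set r] = 0.
Proof.
have mr : measurable (first_coord @^-1` [set r]).
  by rewrite -[X in measurable X]setTI; exact: mfc.
apply/eqP; rewrite eq_le measure_ge0 andbT.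
rewrite [leLHS]lawE (@le_trans _ _ (G (first_coord @^-1` [set r])))//.
  by rewrite le_measure ?inE//; exact: measurableI.
rewrite GE// big1// => k _.
rewrite (_ : _ @^-1` _ = [set ((r - x k ord0 ord0) / s)%R]).
  by rewrite [X in _ * X]normal_prob_set1 mule0.
apply/seteqP; split => t; rewrite /= /first_coord /L mxE axisE eqxx mulr1.
  by move=> <-; rewrite addrAC subrr add0r mulfK ?gt_eqF.
by move=> ->; rewrite divfK ?gt_eqF// addrC subrK.
Qed.

Let law_target j : as_finite (law_lt_pinfty j) setT = target j setT.
Proof.
rewrite [LHS]lawE preimage_setT setTI GE// targetE; apply: eq_bigr => k _.
by rewrite cE snu.1 muleC.
Qed.

Let J := sval (cid (voronoi_index x N0)).
Let UJ v j : U j v <-> J v = j. Proof. exact: (svalP (cid (voronoi_index x N0))). Qed.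

Let UJL k t j : (L k @^-1` U j) t <-> J (L k t) = j. Proof. exact: UJ. Qed.

Let Jmin v k : (norm1 (v - x (J v)) <= norm1 (v - x k))%R.
Proof. exact: (voronoi_min UJ). Qed.

Let c_sum k : \sum_(j < N) (c k j)%:E = 1.
Proof.
rewrite -(probability_setT gam) (measure_partition gam (fun j => mLV k (mU j)) (UJL k))//.
by apply: eq_bigr => j _; rewrite cE setTI.
Qed.

Let W : \bar R := \int[gam]_t (`|t * s|)%:E.

Let norm_L k (t : R) : norm1 (L k t - x k) = `|t * s|%R.
Proof. exact: norm1_axis_line. Qed.

Let mEnorm d (T : measurableType d) (f : T -> 'rV[R]_m.+1) :
  measurable_fun setT f -> measurable_fun setT (fun v => (norm1 (f v))%:E).
Proof. by move=> mf; apply/measurable_EFinP; exact: measurable_norm1. Qed.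

Let Enorm_ge0 (v : 'rV[R]_m.+1) : 0 <= (norm1 v)%:E.
Proof. by rewrite lee_fin norm1_ge0. Qed.

Let mW : measurable_fun setT (fun t : measurableTypeR R => (`|t * s|)%:E).
Proof.
by apply/measurable_EFinP; apply: measurableT_comp => //; exact: measurable_funM.
Qed.

Let mean_avg : \sum_(k < N) (N%:R^-1)%:E * W = W.
Proof. exact: sum_mean. Qed.

Lemma near_optimal_map : exists2 T, transport_maps (gaussian_mixture x (axis_cov m s)) P T &
  \int[gaussian_mixture x (axis_cov m s)]_v (norm1 (v - T v))%:E <=
  split_cost x nu + 3%:E * \int[normal_prob 0 1]_(t in [set: measurableTypeR R]) (`|t * s|)%:E.
Proof.
have /choice[S SP] : forall j, exists S : measurableTypeR R -> 'rV[R]_m.+1,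
    measurable_fun setT S /\ forall B, measurable B ->
      as_finite (law_lt_pinfty j) (S @^-1` B) = target j B.
  by move=> j; have [S mS SE] := atomless_transport (law_set1 j) (law_target j); exists S.
have mS j : measurable_fun setT (S j) by have [] := SP j.
have mSc j : measurable_fun setT (S j \o first_coord) by exact: measurableT_comp.
pose T v := S (J v) (first_coord v).
have mT : measurable_fun setT T by exact: (measurable_piecewise mU UJ mSc).
exists T.
  split => // B mB; rewrite /pushforward.
  have mTB : measurable (T @^-1` B) by rewrite -[X in measurable X]setTI; exact: mT.
  rewrite -[LHS]/(G _) (measure_partition G mU UJ)//.
  rewrite (eq_bigr (fun j => target j B)); last first.
    move=> j _; have [_ <-//] := SP j; rewrite [RHS]lawE; congr (G _).
    by apply/seteqP; split => v [TB Uv]; split => //; move: TB; rewrite /T/= ((UJ v j).1 Uv).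
  under eq_bigr do rewrite targetE.
  rewrite exchange_big/= snu.2//; apply: eq_bigr => k _.
  rewrite -ge0_sume_distrl ?c_sum ?mul1e// => j _; rewrite lee_fin//.
have mx : measurable_fun setT (fun v : 'rV[R]_m.+1 => x (J v)).
  by apply: (measurable_piecewise mU UJ (F := fun j => cst (x j))) => j; exact: measurable_cst.
have mJd : measurable_fun setT (fun v : 'rV[R]_m.+1 => (norm1 (v - x (J v)))%:E).
  exact: (measurable_voronoi_dist UJ).
have mTd : measurable_fun setT (fun v : 'rV[R]_m.+1 => (norm1 (T v - x (J v)))%:E).
  by apply: mEnorm; exact: measurable_rVB.
have le1 : \int[G]_v (norm1 (v - x (J v)))%:E <= W.
  by apply: (integral_voronoi_dist UJ) => //; exact: ltW.
have le2 : \int[G]_v (norm1 (T v - x (J v)))%:E <= split_cost x nu + 2%:E * W.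
  have mSd j : measurable_fun setT (fun r : measurableTypeR R => (norm1 (S j r - x j))%:E).
    by apply: mEnorm; exact: measurable_rVB.
  have mxd j : measurable_fun setT (fun y : 'rV[R]_m.+1 => (norm1 (y - x j))%:E).
    by apply: mEnorm; exact: measurable_rVB.
  (* Inside cell [j] the integrand depends on [v] only through [T v], whose law there is
     [target j]. *)
  have cell j : \int[G]_(v in U j) (norm1 (T v - x (J v)))%:E =
      \sum_(k < N) (c k j)%:E * \int[nu k]_y (norm1 (y - x j))%:E.
    pose SM := measure_function_pushforward__canonical__measure_function_Measure
      (law j) (mS j).
    transitivity (\int[SM]_y (norm1 (y - x j))%:E).
      rewrite ge0_integral_pushforward//= preimage_setT.
      rewrite ge0_integral_pushforward//= preimage_setT ge0_integral_mrestr//.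
        by apply: eq_integral => v /set_mem Uv; rewrite /T ((UJ v j).1 Uv).
      exact: (measurableT_comp (mSd j) mfc).
    apply: ge0_integral_lincomb => //.
    by move=> A mA; rewrite -targetE -(SP j).2.
  rewrite (integral_partition G mU UJ)//.
  rewrite (eq_bigr _ (fun j _ => cell j)) exchange_big/=.
  rewrite /split_cost -mean_avg.
  rewrite ge0_sume_distrr; last by move=> k _; rewrite mule_ge0// integral_ge0.
  rewrite -big_split/=; apply: lee_sum => k _.
  have mJk : measurable_fun setT (fun t => (norm1 (x k - x (J (L k t))))%:E).
    apply: mEnorm; apply: measurable_rVB => //; exact: (measurableT_comp mx (mL k)).
  (* On the cell of x j, |x k - x j| <= 2 |v - x k|, and v - x k = s t e_1. *)
  have step j : (c k j)%:E * \int[nu k]_y (norm1 (y - x j))%:E <=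
      (c k j)%:E * \int[nu k]_y (norm1 (y - x k))%:E +
      (N%:R^-1)%:E * \int[gam]_(t in L k @^-1` U j) (norm1 (x k - x (J (L k t))))%:E.
    have -> : \int[gam]_(t in L k @^-1` U j) (norm1 (x k - x (J (L k t))))%:E =
        (norm1 (x k - x j))%:E * (c k j)%:E.
      rewrite cE -integral_cst; last exact: mLV.
      by apply: eq_integral => t /set_mem Ut; rewrite ((UJL k t j).1 Ut).
    rewrite [X in _ <= _ + X]muleA [X in _ <= _ + X]muleC -ge0_muleDr; last 2 first.
    - exact: integral_ge0.
    - by rewrite mule_ge0// lee_fin invr_ge0.
    apply: lee_wpmul2l; first by rewrite lee_fin.
    rewrite -(snu.1 k) muleC -integral_cst//= -ge0_integralD//.
    apply: ge0_le_integral => //.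
    - by apply: emeasurable_funD => //.
    - by move=> y _; rewrite -EFinD lee_fin norm1_tri.
  apply: (le_trans (lee_sum _ (fun j _ => step j))).
  rewrite big_split/=; apply: leeD.
    rewrite -ge0_sume_distrl ?c_sum ?mul1e// => j _; by rewrite lee_fin.
  rewrite -ge0_sume_distrr; last by move=> j _; exact: integral_ge0.
  rewrite muleCA lee_pmul2l ?lte_fin ?invr_gt0 ?ltr0n//.
  rewrite -(integral_partition gam (fun j => mLV k (mU j)) (UJL k))//.
  rewrite /W -ge0_integralZl_EFin//.
  apply: ge0_le_integral => //.
  - exact: measurable_funeM.
  move=> t _; rewrite -EFinM lee_fin.
  apply: (le_trans (norm1_tri _ (L k t) _)).
  by rewrite mulr_natl mulr2n lerD// ?(norm1C (x k)) ?norm_L// -(norm_L k) Jmin.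
(* The way from [v] to [T v] passes through the nearest sample point: the first leg costs at most
   [W], the second at most the split cost plus [2 W]. *)
apply: (@le_trans _ _ (\int[G]_v ((norm1 (v - x (J v)))%:E + (norm1 (T v - x (J v)))%:E))).
  apply: ge0_le_integral => //.
  - by apply: mEnorm; exact: measurable_rVB.
  - exact: emeasurable_funD.
  - by move=> v _; rewrite -EFinD lee_fin (norm1C (T v)) norm1_tri.
rewrite ge0_integralD//.
apply: (le_trans (leeD le1 le2)); rewrite addeCA leeD2l//.
rewrite -[X in X + _ <= _]mul1e -ge0_muleDl//.
Qed.

End near_optimal_map.

(** * Lower approximation of a function by its Gaussian means *)

Section lebesgue_affine.
Context {R : realType}.
Local Open Scope ereal_scope.
Local Notation mu := (@lebesgue_measure R).

Lemma lebesgue_measure_affine (r s : R) (A : set (measurableTypeR R)) : (0 < s)%R ->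
  measurable A -> s%:E * mu [set t | A (r + t * s)%R] = mu A.
Proof.
move=> s0 mA.
have mf : measurable_fun setT (fun t : measurableTypeR R => (r + t * s)%R : measurableTypeR R).
  by apply: measurable_funD => //; exact: measurable_funM.
pose nu : {measure set (measurableTypeR R) -> \bar R} := mscale (NngNum (ltW s0))
  (measure_function_pushforward__canonical__measure_function_Measure mu mf).
apply/esym; rewrite -[RHS]/(nu A).
apply: lebesgue_measure_unique => // _ [[a b] /= _ <-].
rewrite /nu/= /mscale/= /pushforward.
rewrite (_ : _ @^-1` _ = `](a - r) / s, (b - r) / s]%classic)%R; last first.
  apply/seteqP; split => t /=; rewrite !in_itv/= ltr_pdivrMr// ler_pdivlMr//;
    by rewrite ltrBlDl lerBrDl.
rewrite !lebesgue_measure_itv/= !lte_fin ltr_pM2r ?invr_gt0// ltrD2r.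
case: ifPn => ab; last by rewrite mule0.
by rewrite -!EFinD -EFinM -mulrBl mulrC divfK ?gt_eqF// opprB addrA subrK.
Qed.

Lemma normal_prob_le_lebesgue (A : set (measurableTypeR R)) : measurable A ->
  normal_prob 0 1 A <= (normal_peak 1)%:E * mu A.
Proof.
move=> mA; rewrite /normal_prob -integral_cst//; apply: ge0_le_integral => //.
- by move=> t _; rewrite lee_fin normal_pdf_ge0.
- by apply/measurable_EFinP; apply: measurable_funTS; exact: measurable_normal_pdf.
- by move=> t _; rewrite lee_fin normal_pdf_ub ?oner_eq0.
Qed.

Lemma near_lt_of_cvg0 T (F : set_system T) {FF : Filter F} (X : T -> \bar R) (e : R) :
  (0 < e)%R -> X t @[t --> F] --> 0 -> \forall t \near F, X t < e%:E.
Proof.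
move=> e0 /(_ [set y | y < e%:E]); apply; apply: open_nbhs_nbhs; split.
  exact: open_ereal_lt_ereal.
by rewrite /= lte_fin.
Qed.

Lemma normal_prob_tail (e : R) : (0 < e)%R ->
  exists2 M : R, (0 < M)%R & normal_prob 0 1 (~` ball (0%R : R) M) < e%:E.
Proof.
move=> e0; pose F (n : nat) := ~` ball (0%R : R) n%:R.
have mF n : measurable (F n : set (measurableTypeR R)) by apply: measurableC; exact: measurable_ball.
have F0 : \bigcap_n F n = set0.
  apply/seteqP; split => // t /(_ (Num.truncn `|t|%R).+1 Logic.I); apply.
  by rewrite /ball/= sub0r normrN truncnS_gt.
pose g : probability (measurableTypeR R) R := normal_prob 0%R 1%R.
have : g (F n) @[n --> \oo] --> g set0.
  rewrite -F0; apply: (@nonincreasing_cvg_mu _ (measurableTypeR R)) => //.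
  - by rewrite -ge0_fin_numE//; apply: fin_num_measure; exact: mF.
  - by rewrite F0.
  - move=> i j ij; apply/subsetPset; apply: subsetC; apply: le_ball.
    by rewrite ler_nat.
rewrite measure0 => /(near_lt_of_cvg0 e0)[n _ /(_ n.+1 (leqnSn n)) ge].
by exists n.+1%:R.
Qed.

(** The normal law is split at radius [M]: the tail is small uniformly in [s], while on the ball the
    density is at most its peak, and rescaling turns the bound into the relative Lebesgue measure of
    [B] in the ball of radius [M * s]. *)
Lemma density0_normal (B : set (measurableTypeR R)) (r : R) :
  measurable B ->
  mu (B `&` ball r rho) * (mu (ball r rho))^-1 @[rho --> 0^'+] --> 0 ->
  forall e : R, (0 < e)%R -> \forall s \near 0^'+,
    normal_prob 0 1 ([set t | B (r + t * s)%R] : set (measurableTypeR R)) < e%:E.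
Proof.
move=> mB dens e e0; have e20 : (0 < e / 2)%R by rewrite divr_gt0.
have [M M0 tailM] := normal_prob_tail e20.
(* Peak of the density times the length of the ball of radius [M]: the factor by which relative
   Lebesgue measure bounds normal probability. Dividing by [c + 1] below avoids having to exclude
   [c = 0]. *)
pose c : R := (normal_peak 1 * (M *+ 2))%R.
have c0 : (0 <= c)%R by rewrite mulr_ge0 ?(normal_peak_ge0 1)// mulrn_wge0 ?ltW.
have ec0 : (0 < e / 2 / (c + 1))%R by rewrite divr_gt0// ltr_wpDl.
have [dl /= dl0 small] := near_lt_of_cvg0 ec0 dens.
near=> s.
have s0 : (0 < s)%R by near: s; exact: nbhs_right_gt.
have sdl : (M * s < dl)%R.
  rewrite mulrC -ltr_pdivlMr//; near: s; apply: nbhs_right_lt.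
  by rewrite divr_gt0.
have Ms0 : (0 < M * s)%R by rewrite mulr_gt0.
have := small (M * s)%R; rewrite /= sub0r normrN gtr0_norm// => /(_ sdl Ms0).
rewrite lebesgue_measure_ball; last exact: ltW.
rewrite inver mulrn_eq0/= gt_eqF// => smallMs.
pose A := [set t | (B `&` ball r (M * s)%R) (r + t * s)%R] : set (measurableTypeR R).
have mBb : measurable (B `&` ball r (M * s)%R : set (measurableTypeR R)).
  by apply: measurableI => //; exact: measurable_ball.
have mf : measurable_fun setT (fun t : measurableTypeR R => (r + t * s)%R : measurableTypeR R).
  by apply: measurable_funD => //; exact: measurable_funM.
have mpre C : measurable C -> measurable ((fun t : measurableTypeR R => (r + t * s)%R : measurableTypeR R) @^-1` C).
  by move=> mC; rewrite -[X in measurable X]setTI; exact: mf.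
have mA : measurable A by exact: (mpre _ mBb).
have mT : measurable (~` ball (0%R : R) M : set (measurableTypeR R)).
  by apply: measurableC; exact: measurable_ball.
pose g : probability (measurableTypeR R) R := normal_prob 0%R 1%R.
apply: (@le_lt_trans _ _ (g (A `|` ~` ball (0%R : R) M))).
  apply: (@le_measure _ _ _ g); rewrite ?inE//.
  - exact: (mpre _ mB).
  - exact: measurableU.
  - move=> t /= Bt; have [tM|tM] := pselect (ball (0%R : R) M t); last by right.
    left; split => //; move: tM; rewrite /ball/= sub0r normrN => tM.
    by rewrite opprD addNKr normrN normrM (gtr0_norm s0) ltr_pM2r.
apply: le_lt_trans; first exact: measureU2.
rewrite [e]splitr EFinD; apply: lteD => //.
apply: (le_lt_trans (normal_prob_le_lebesgue mA)).
have Aaff := lebesgue_measure_affine r s0 mBb.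
have bfin : mu (B `&` ball r (M * s)%R) < +oo.
  rewrite (@le_lt_trans _ _ (mu (ball r (M * s)%R)))//.
    by apply: le_measure; rewrite ?inE//; exact: measurable_ball.
  by rewrite lebesgue_measure_ball ?ltry ?ltW.
have : 0 <= mu A by [].
move: Aaff bfin smallMs; rewrite -/A.
case: (mu A) => [al <- _| <-|//]; last by rewrite mulry gtr0_sg// mul1e.
rewrite -!EFinM !lte_fin lee_fin => smallMs al0.
have al_lt : (al < e / 2 / (c + 1) * (M *+ 2))%R.
  move: smallMs; rewrite ltr_pdivrMr ?mulrn_wgt0//.
  by rewrite -mulrnAl mulrA mulrC ltr_pM2r.
apply: (@le_lt_trans _ _ (c * (e / 2 / (c + 1))))%R.
  rewrite /c -[leRHS]mulrA ler_wpM2l ?(normal_peak_ge0 1)// mulrC; exact: ltW.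
by rewrite mulrA ltr_pdivrMr ?ltr_wpDl// mulrDr mulr1 mulrC ltrDl.
Unshelve. all: by end_near. Qed.
End lebesgue_affine.

Section gaussian_lower_approximation.
Context {R : realType}.
Local Open Scope ereal_scope.
Local Notation mu := (@lebesgue_measure R).

Definition smooth_approx (f : R -> R) (r : R) : Prop := forall n, exists L, forall l : nat,
  (L <= l)%N -> (f r)%:E <=
    \int[normal_prob 0 1]_(t in [set: measurableTypeR R]) (f (r + t * l.+1%:R^-1)%R)%:E
    + (n.+1%:R^-1)%:E.

(** The density theorem is applied to the sublevel sets [B q] for rational [q], countably many,
    hence with one null set. If [q < f r], then [r] is a point of density 0 of [B q], so narrow
    Gaussians at [r] live mostly where [f > q], which bounds their mean of the nonnegative [f] from
    below. *)
Lemma ae_smooth_approx (f : measurableTypeR R -> R) :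
  measurable_fun setT f -> (forall r, (0 <= f r)%R) ->
  {ae mu, forall r, smooth_approx f r}.
Proof.
move=> mf f0.
pose B (q : rat) : set (measurableTypeR R) := [set r | (f r <= ratr q)%R].
have mB q : measurable (B q).
  by rewrite -[X in measurable X]setTI; apply: measurable_fun_ler.
pose D q (r : R) := mu (B q `&` ball r rho) * (mu (ball r rho))^-1 @[rho --> 0^'+]
  --> (\1_(B q) r)%:E.
have aeD : {ae mu, forall r, forall k : nat,
    if (unpickle k : option rat) is Some q then D q r else True}.
  apply: ae_foralln => k; case: (unpickle k) => [q|]; last by apply: aeW.
  have := lebesgue_density (mB q); exact.
have FF := ae_filter_ringOfSetsType mu.
apply: (@filterS _ _ FF _ _ _ aeD) => r dens n.
have Dq q : D q r by have := dens (pickle q); rewrite pickleK.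
pose d : R := (n.+1%:R^-1 / 2)%R.
have d0 : (0 < d)%R by rewrite divr_gt0// invr_gt0.
pose g : probability (measurableTypeR R) R := normal_prob 0%R 1%R.
pose I (l : nat) := \int[g]_t (f (r + t * l.+1%:R^-1)%R)%:E.
have I0 l : 0 <= I l by apply: integral_ge0 => t _; rewrite lee_fin.
have dn : (n.+1%:R^-1 = d + d)%R by rewrite /d -splitr.
have [q] : exists q : rat, (f r - d < ratr q < f r)%R.
  have : (f r - d < f r)%R by rewrite ltrBlDr ltrDl.
  by move=> /rat_in_itvoo[q]; rewrite in_itv/= => ?; exists q.
move=> /andP[q1 q2].
have [qneg|qpos] := leP (ratr q : R)%R 0%R.
  exists 0%N => l _; apply: (@le_trans _ _ (n.+1%:R^-1)%:E).
    rewrite lee_fin dn; move: q1 qneg d0; lra.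
  by rewrite leeDr//; exact: I0.
have rB : ~ B q r by rewrite /B/= leNgt q2.
have := Dq q; rewrite /D indicE memNset//= => dens0.
(* Mass at most [d / q] on [B q] costs at most [d] in the mean; with the gap [d] between [q] and
   [f r] this fills the tolerance 1/(n+1). *)
have e0 : (0 < d / ratr q)%R by rewrite divr_gt0.
have [dl /= dl0 near0] := density0_normal (mB q) dens0 e0.
have [L _ LP] : \forall l \near \oo, (l.+1%:R^-1 < dl)%R by exact: near_infty_natSinv_lt (PosNum dl0).
exists L => l /LP ldl.
have s0 : (0 < l.+1%:R^-1 :> R)%R by rewrite invr_gt0.
have small := near0 (l.+1%:R^-1)%R; rewrite /= sub0r normrN gtr0_norm// in small.
have {small} := small ldl s0.
set C := [set t | _] => gC.
have mline : measurable_fun setT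
    (fun t : measurableTypeR R => (r + t * l.+1%:R^-1)%R : measurableTypeR R).
  by apply: measurable_funD => //; exact: measurable_funM.
have mC : measurable (C : set (measurableTypeR R)).
  by rewrite -[X in measurable X]setTI; exact: (mline measurableT _ (mB q)).
have mI : measurable_fun setT (fun t : measurableTypeR R => (f (r + t * l.+1%:R^-1)%R)%:E).
  by apply/measurable_EFinP; exact: (measurableT_comp mf mline).
have q0 := ltW qpos.
have mCi : measurable_fun setT (fun t : measurableTypeR R => (\1_C t)%:E : \bar R).
  by apply/measurable_EFinP; exact: measurable_indic.
have mCq : measurable_fun setT (fun t : measurableTypeR R => (ratr q)%:E * (\1_C t)%:E : \bar R).
  exact: measurable_funeM.
have qI : (ratr q)%:E <= I l + (ratr q)%:E * g C.
  rewrite -[X in X <= _]mule1 -(probability_setT g) -integral_cst//.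
  have -> : g C = \int[g]_t (\1_C t)%:E by rewrite integral_indic// setIT.
  rewrite -ge0_integralZl_EFin// -ge0_integralD//; last 2 first.
  - by move=> t _; rewrite lee_fin.
  - by move=> t _; rewrite mule_ge0// lee_fin.
  apply: ge0_le_integral => //.
  exact: emeasurable_funD.
  move=> t _; rewrite -EFinM -EFinD lee_fin indicE.
  have [tC|tC] := boolP (t \in C); first by rewrite mulr1 lerDr.
  rewrite mulr0 addr0 leNgt; apply/negP => fq; move/negP: tC; apply.
  by apply/mem_set; exact: ltW.
apply: (@le_trans _ _ ((ratr q)%:E + d%:E)).
  by rewrite -EFinD lee_fin -lerBlDr ltW.
rewrite dn EFinD addeA; apply: leeD => //; apply: (le_trans qI); apply: leeD => //.
apply: (@le_trans _ _ ((ratr q)%:E * (d / ratr q)%:E)).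
  by apply: lee_wpmul2l; [rewrite lee_fin ltW|exact: ltW].
by rewrite -EFinM lee_fin mulrC divfK// gt_eqF.
Qed.

End gaussian_lower_approximation.

Section gaussian_lower_approximation_rV.
Context {R : realType} (m : nat).
Local Open Scope ereal_scope.
Variable f : 'rV[R]_m.+1 -> R.
Hypotheses (mf : measurable_fun setT f) (f0 : forall v, (0 <= f v)%R).

Definition axis_approx (v : 'rV[R]_m.+1) : Prop := forall n, exists L, forall l : nat,
  (L <= l)%N -> (f v)%:E <=
    \int[normal_prob 0 1]_(t in [set: measurableTypeR R])
      (f (v + axis m (t * l.+1%:R^-1))%R)%:E + (n.+1%:R^-1)%:E.

Let gam : probability (measurableTypeR R) R := normal_prob 0%R 1%R.

Lemma measurable_axis_mean (s : R) : measurable_fun setT (fun v : 'rV[R]_m.+1 =>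
  \int[normal_prob 0 1]_(t in [set: measurableTypeR R]) (f (v + axis m (t * s))%R)%:E).
Proof.
pose F (z : 'rV[R]_m.+1 * measurableTypeR R) := (f (z.1 + axis m (z.2 * s))%R)%:E.
apply: (@measurable_fun_fubini_tonelli_F _ _ _ _ R gam F).
  apply/measurable_EFinP; apply: (measurableT_comp mf).
  apply: measurable_fun_rVP => i.
  rewrite (_ : (fun _ => _) = fun z : 'rV[R]_m.+1 * measurableTypeR R =>
    z.1 ord0 i + z.2 * s * (i == ord0)%:R)%R; last first.
    by apply/funext => z; rewrite mxE axisE.
  apply: measurable_funD.
    exact: (measurableT_comp (measurable_coord i) measurable_fst).
  by apply: measurable_funM => //; apply: measurable_funM => //; exact: measurable_snd.
by move=> z; rewrite lee_fin.
Qed.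

Lemma measurable_axis_approx : measurable [set v | axis_approx v].
Proof.
rewrite (_ : mkset _ = \bigcap_n \bigcup_L \bigcap_(l in [set l | (L <= l)%N])
    [set v | (f v)%:E <= \int[normal_prob 0 1]_(t in [set: measurableTypeR R])
      (f (v + axis m (t * l.+1%:R^-1))%R)%:E + (n.+1%:R^-1)%:E]).
  apply: bigcapT_measurable => n; apply: bigcupT_measurable => L.
  apply: bigcap_measurableType => l _.
  rewrite -[X in measurable X]setTI; apply: measurable_lee => //.
    exact/measurable_EFinP.
  by apply: emeasurable_funD => //; exact: measurable_axis_mean.
apply/seteqP; split => v /= h n; have := h n.
  by move=> [L hL] _; exists L.
by move=> /(_ Logic.I)[L _ hL]; exists L.
Qed.

Lemma consv_axis (r t : R) (y : 'rV[R]_m) :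
  (consv (r, y) + axis m t)%R = consv ((r + t)%R, y) :> 'rV[R]_m.+1.
Proof.
apply/rowP => i; rewrite mxE axisE /consv/=.
case: (@splitP 1 m i) => j ij.
  have -> : i = lshift m j by apply/val_inj.
  by rewrite !(@row_mxEl _ 1 1 m) !mxE !ord1 mulr1.
have -> : i = rshift 1 j by apply/val_inj.
by rewrite !(@row_mxEr _ 1 1 m) mulr0 addr0.
Qed.

(** By Fubini it suffices to look at the lines with the last [m] coordinates fixed; displacement by
    [axis] stays on such a line, where the one-dimensional statement applies. *)
Lemma lebesgue_axis_approx : lebesgue_rV m.+1 [set v | ~ axis_approx v] = 0.
Proof.
pose bad := [set v | ~ axis_approx v].
have mbad : measurable bad by apply: measurableC; exact: measurable_axis_approx.
have mE : measurable (@consv R m @^-1` bad).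
  by rewrite -[X in measurable X]setTI; exact: measurable_consv.
rewrite /lebesgue_rV/= /cons_measure /pushforward.
have := indic_fubini_tonelli lebesgue_measure (power_measure lebesgue_measure m) mE.
rewrite indic_fubini_tonelli_FE// => FG; apply: (etrans FG).
rewrite indic_fubini_tonelli_GE//; apply: integral0_eq => y _ /=.
pose fy (r : measurableTypeR R) : R := f (consv (r, y)).
have mfy : measurable_fun setT fy.
  apply: (measurableT_comp mf); apply: (measurableT_comp (@measurable_consv R m)).
  exact: measurable_fun_pair.
have fy0 r : (0 <= fy r)%R by exact: f0.
have mys : measurable (ysection (@consv R m @^-1` bad) y) by exact: measurable_ysection.
apply/(negligibleP lebesgue_measure mys).
apply: negligibleS (ae_smooth_approx mfy fy0) => r; rewrite /ysection/= inE => bad_r.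
move=> good_r; apply: bad_r => n; have [L hL] := good_r n; exists L => l Ll.
apply: (le_trans (hL l Ll)); rewrite /fy.
by under [in leRHS]eq_integral do rewrite consv_axis.
Qed.

Lemma dominated_axis_approx (P : probability 'rV[R]_m.+1 R) :
  P `<< lebesgue_rV m.+1 -> P [set v | ~ axis_approx v] = 0.
Proof.
move=> /null_content_dominatesP; apply; last exact: lebesgue_axis_approx.
by apply: measurableC; exact: measurable_axis_approx.
Qed.

End gaussian_lower_approximation_rV.

(** * The mean displacement of the observations *)

Section normal_first_moment.
Context {R : realType}.
Local Open Scope ereal_scope.
Local Notation mu := (@lebesgue_measure R).

(** The Radon-Nikodym derivative and [normal_pdf] have the same integral over every measurable set,
    hence agree almost everywhere. *)
Lemma ge0_integral_normal_prob (f : measurableTypeR R -> \bar R) :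
  measurable_fun setT f -> (forall t, 0 <= f t) ->
  \int[normal_prob 0 1]_(t in [set: measurableTypeR R]) f t =
  \int[mu]_t (f t * (normal_pdf 0 1 t)%:E).
Proof.
move=> mf f0.
pose g : probability (measurableTypeR R) R := normal_prob 0%R 1%R.
have gmu : g `<< mu by exact: normal_prob_dominates.
rewrite -(Radon_Nikodym_SigmaFinite.change_of_variables gmu f0)//.
have mpdf : measurable_fun setT (fun t : measurableTypeR R => (normal_pdf (0 : R)%R 1 t)%:E).
  by apply/measurable_EFinP; exact: measurable_normal_pdf.
have intRN := Radon_Nikodym_SigmaFinite.f_integrable gmu.
apply: ae_eq_integral => //.
- by apply: emeasurable_funM => //; exact: (measurable_int mu).
- exact: emeasurable_funM.
- apply: ae_eqe_mul2l; apply: integral_ae_eq => // E _ mE.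
  by rewrite -Radon_Nikodym_SigmaFinite.f_integral.
Qed.

Lemma normal_abs_moment_lty :
  \int[normal_prob 0 1]_(t in [set: measurableTypeR R]) (`|t|)%:E < +oo.
Proof.
have mabs : measurable_fun setT (fun t : measurableTypeR R => (`|t|%R)%:E : \bar R).
  by apply/measurable_EFinP; exact: normr_measurable.
rewrite ge0_integral_normal_prob//.
(* Comparison with the normal density of standard deviation 2: [c] is the ratio of the normalizing
   constants, and the exponents differ by 3 t^2 / 8, which absorbs the factor |t|. *)
pose c : R := (normal_peak 1 / normal_peak 2)%R.
have peak2 : (0 < normal_peak (2 : R))%R by rewrite normal_peak_gt0.
have c0 : (0 <= c)%R by rewrite divr_ge0// normal_peak_ge0.
have mpdf s : measurable_fun setT (fun t : measurableTypeR R => (normal_pdf (0 : R)%R s t)%:E).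
  by apply/measurable_EFinP; exact: measurable_normal_pdf.
apply: (@le_lt_trans _ _ (\int[mu]_t (c%:E * (normal_pdf 0 2 t)%:E))); last first.
  rewrite ge0_integralZl_EFin//; last by move=> t _; rewrite lee_fin normal_pdf_ge0.
  by rewrite integral_normal_pdf mule1 ltry.
apply: ge0_le_integral => //.
- by move=> t _; rewrite mule_ge0// lee_fin normal_pdf_ge0.
- exact: emeasurable_funM.
- exact: measurable_funeM.
- move=> t _; rewrite -!EFinM lee_fin !normal_pdfE ?oner_eq0 ?pnatr_eq0//.
  rewrite /c [leRHS]mulrA divfK ?gt_eqF// mulrCA ler_wpM2l ?normal_peak_ge0//.
  rewrite /normal_fun subr0.
  (* [|t| <= exp (3 t^2 / 8)] since [2 |t| sqrt (3/8) <= 1 + 3 t^2 / 8] *)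
  apply: (@le_trans _ _ (expR (3 / 8 * t ^+ 2) * expR (- t ^+ 2 / (1 ^+ 2 *+ 2)))%R).
    rewrite ler_wpM2r ?expR_ge0//; apply: le_trans (expR_ge1Dx _).
    rewrite -real_normK ?num_real//; move: `|t|%R => u.
    have : (0 <= (u * 3 / 4 - 1) ^+ 2)%R by exact: sqr_ge0.
    rewrite !expr2; nra.
  rewrite -expRD ler_expR.
  by rewrite le_eqVlt; apply/orP; left; apply/eqP; field.
Qed.

End normal_first_moment.

Section observed_ball.
Context {R : realType} (m N : nat) (P : probability 'rV[R]_m.+1 R).
Variable x : 'I_N -> 'rV[R]_m.+1.
Hypotheses (N0 : (0 < N)%N) (P_ac : P `<< lebesgue_rV m.+1).
Local Open Scope ereal_scope.

Lemma dominated_set1 v : P [set v] = 0.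
Proof.
have /null_content_dominatesP := P_ac; apply; first exact: measurable_rV1.
apply/eqP; rewrite eq_le measure_ge0 andbT.
rewrite /lebesgue_rV/= /cons_measure /pushforward.
have m1 : measurable ([set v ord0 ord0] : set (measurableTypeR R)) by exact: measurable_set1.
rewrite (@le_trans _ _ ((lebesgue_measure \x power_measure lebesgue_measure m)
    ([set v ord0 ord0] `*` setT)))//; last first.
  by rewrite product_measure1E// [X in X * _](lebesgue_measure_set1 (v ord0 ord0)) mul0e.
apply: (@le_measure _ _ _ (lebesgue_measure \x power_measure lebesgue_measure m)); rewrite ?inE//.
- by rewrite -[X in measurable X]setTI; apply: measurable_consv => //; exact: measurable_rV1.
- exact: measurableX.
move=> [t y] /= tyv; split => //=; rewrite -tyv /consv/=.
have -> : (ord0 : 'I_m.+1) = lshift m (ord0 : 'I_1) by apply/val_inj.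
by rewrite (@row_mxEl _ 1 1 m) mxE mulr1n.
Qed.

Lemma norm1_eq0 n (u : 'rV[R]_n) : norm1 u = 0%R -> u = 0%R.
Proof.
move=> /eqP; rewrite psumr_eq0// => /allP u0; apply/rowP => i; rewrite mxE.
by have := u0 i; rewrite mem_index_enum normr_eq0 => /(_ isT)/eqP.
Qed.

Section nearest.
Variable J : 'rV[R]_m.+1 -> 'I_N.
Hypothesis UJ : forall v j, voronoi x j v <-> J v = j.

(** A zero integral would concentrate [P] on the finite sample, although it gives no mass to
    points. *)
Lemma integral_voronoi_dist_gt0 : 0 < \int[P]_v (norm1 (v - x (J v)))%:E.
Proof.
rewrite lt_neqAle integral_ge0 ?andbT; last by move=> v _; rewrite lee_fin norm1_ge0.
apply/negP => /eqP int0.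
have : \int[P]_v `|(norm1 (v - x (J v)))%:E| = 0.
  rewrite [RHS]int0; apply: eq_integral => v _.
  by rewrite gee0_abs// lee_fin norm1_ge0.
move=> /(ae_eq_integral_abs P measurableT (measurable_voronoi_dist UJ)) ae0.
have ax : {ae P, forall v, forall k : 'I_N, v <> x k}.
  apply: filter_forall => k; exists [set x k]; split.
  - exact: measurable_rV1.
  - exact: dominated_set1.
  - by move=> v /= /contrapT.
have [Z [mZ Z0 sZ]] : {ae P, forall v : 'rV[R]_m.+1, False}.
  apply: filterS2 ae0 ax => v /= /(_ Logic.I)[/norm1_eq0/subr0_eq vx] /(_ (J v)).
  exact.
have ZT : Z = setT by apply/seteqP; split => // v _; apply: sZ.
by move: Z0; rewrite ZT probability_setT => /eqP; rewrite onee_eq0.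
Qed.

(** [T v] has law [P], and its distance to the sample is at most its distance to [v] plus that of
    [v] to the sample. Read backwards, this bounds the cost of every transport map from below. *)
Lemma voronoi_dist_transport (s : R) T : (0 <= s)%R ->
  transport_maps (gaussian_mixture x (axis_cov m s)) P T ->
  \int[P]_v (norm1 (v - x (J v)))%:E <=
  \int[gaussian_mixture x (axis_cov m s)]_v (norm1 (v - T v))%:E +
  \int[normal_prob 0 1]_(t in [set: measurableTypeR R]) (`|t * s|)%:E.
Proof.
move=> s0 [mT TP].
pose G : {measure set 'rV[R]_m.+1 -> \bar R} := gaussian_mixture x (axis_cov m s).
have md := measurable_voronoi_dist UJ.
have mTd : measurable_fun setT (fun v : 'rV[R]_m.+1 => (norm1 (v - T v))%:E).
  by apply/measurable_EFinP; apply: measurable_norm1; exact: measurable_rVB.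
pose GT := measure_function_pushforward__canonical__measure_function_Measure G mT.
rewrite (eq_measure_integral GT); last by move=> A mA _; exact/esym/TP.
rewrite ge0_integral_pushforward//=; last by move=> v _; rewrite lee_fin norm1_ge0.
rewrite preimage_setT.
apply: (@le_trans _ _ (\int[G]_v ((norm1 (v - T v))%:E + (norm1 (v - x (J v)))%:E))).
  apply: ge0_le_integral => //.
  - by move=> v _; rewrite lee_fin norm1_ge0.
  - exact: (measurableT_comp md mT).
  - exact: emeasurable_funD.
  - move=> v _; rewrite -EFinD lee_fin (le_trans (voronoi_min UJ _ (J v)))//.
    by rewrite (norm1C v (T v)) norm1_tri.
rewrite ge0_integralD//; last 2 first.
- by move=> v _; rewrite lee_fin norm1_ge0.
- by move=> v _; rewrite lee_fin norm1_ge0.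
by rewrite leeD2l// integral_voronoi_dist.
Qed.

End nearest.

End observed_ball.

Section observed_wasserstein.
Context {R : realType} (m N : nat) (P : probability 'rV[R]_m.+1 R).
Variable x : 'I_N -> 'rV[R]_m.+1.
Hypotheses (N0 : (0 < N)%N) (P_ac : P `<< lebesgue_rV m.+1).
Variables (h : 'rV[R]_m.+1 -> 'rV[R]_m.+1) (C eps : R).
Hypothesis mh : measurable_fun setT h.
Hypothesis x_approx : forall k, axis_approx (fun v => norm1 (v - h v)) (x k).
Hypothesis h_inf : inferable P x h C.
Hypothesis x_ball : (wasserstein P (empirical x) <= eps%:E)%E.

Let s (l : nat) : R := l.+1%:R^-1.
Let s_gt0 l : 0 < s l. Proof. by rewrite invr_gt0. Qed.
Let s_cvg : s l @[l --> \oo] --> (0 : R). Proof. exact: cvg_harmonic. Qed.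

Let M1 : R := fine (\int[normal_prob 0 1]_(t in [set: measurableTypeR R]) (`|t|)%:E)%E.

Let M1E l : (\int[normal_prob 0 1]_(t in [set: measurableTypeR R]) (`|t * s l|)%:E)%E = (M1 * s l)%:E.
Proof.
rewrite EFinM fineK; last first.
  by rewrite ge0_fin_numE ?normal_abs_moment_lty// integral_ge0.
rewrite -ge0_integralZr//.
- by apply: eq_integral => t _; rewrite normrM EFinM (gtr0_norm (s_gt0 l)).
- by apply/measurable_EFinP; exact: normr_measurable.
- by rewrite lee_fin ltW.
Qed.

Let axis_cov_cvg : axis_cov m (s l) @[l --> \oo] --> (0 : 'M[R]_m.+1).
Proof.
rewrite -(scale0r (delta_mx ord0 ord0 : 'M[R]_m.+1)).
apply: cvgZr_tmp; rewrite -(mulr0 (0:R)) /=.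
under eq_fun do rewrite expr2.
exact: cvgM.
Qed.

Let f v := norm1 (v - h v).

Let mf : measurable_fun setT f.
Proof. by apply: measurable_norm1; exact: measurable_rVB. Qed.

Let D := mean_dist x (h \o x).

(** The slack [e] spares a proof that an optimal coupling exists. *)
Let cost_le e : 0 < e -> exists2 nu, is_split P nu & (split_cost x nu <= (eps + e)%:E)%E.
Proof.
move=> e0; have : (wasserstein P (empirical x) < (eps + e)%:E)%E.
  by apply: (le_lt_trans x_ball); rewrite lte_fin ltrDl.
move=> /ereal_inf_lt[_ [pi cpi <-] pi_lt].
have [nu snu cnu] := coupling_split cpi.
by exists nu => //; apply: (le_trans cnu); exact: ltW.
Qed.

Let mean_approx n : \forall l \near \oo, (D%:E <=
  \int[gaussian_mixture x (axis_cov m (s l))]_v (f v)%:E + (n.+1%:R^-1)%:E)%E.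
Proof.
have /choice[L LP] k := x_approx k n.
exists (\max_(k < N) L k)%N => // l /= Ll.
rewrite integral_gaussian_mixture_axis//; last 3 first.
- exact: ltW.
- exact/measurable_EFinP.
- by move=> v; rewrite lee_fin norm1_ge0.
rewrite -(sum_mean (n.+1%:R^-1)%:E N0) -big_split/= /D /mean_dist mulr_sumr -sumEFin.
apply: lee_sum => k _; rewrite EFinM -ge0_muleDr//; last first.
  by rewrite integral_ge0// => t _; rewrite lee_fin norm1_ge0.
apply: lee_wpmul2l; first by rewrite lee_fin invr_ge0.
apply: LP; apply: leq_trans Ll; exact: leq_bigmax.
Qed.

Lemma mean_dist_le : D <= C * eps.
Proof.
have cov l : covariance_mx (axis_cov m (s l)) by apply: covariance_scale_delta; exact: sqr_ge0.
have [C_ [C_ineq C_cvg]] := h_inf cov axis_cov_cvg.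
have [J UJ] := voronoi_index x N0.
have K0 := integral_voronoi_dist_gt0 P_ac UJ.
have s_small : \forall l \near \oo, ((M1 * s l)%:E < \int[P]_v (norm1 (v - x (J v)))%:E)%E.
  have Ms_cvg : M1 * s l @[l --> \oo] --> (0 : R).
    by rewrite -(mulr0 M1); apply: cvgMl_tmp; exact: s_cvg.
  move: K0; case: (\int[P]_v _)%E => [k||//]; last by move=> _; apply: nearW => l; rewrite ltry.
  rewrite lte_fin => k0; near=> l; rewrite lte_fin; near: l.
  exact: (cvgr_lt 0 Ms_cvg).
(* A transport map has positive cost for large l, because P has no atom whereas
   the mixture concentrates on the sample; hence C_ l is nonnegative. *)
have key (e : R) n : 0 < e -> \forall l \near \oo, D <= C_ l * (eps + e + 3 * (M1 * s l)) + n.+1%:R^-1.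
  move=> e0; have [nu snu cnu] := cost_le e0.
  near=> l.
  have [T trT Tcost] := near_optimal_map x N0 (s_gt0 l) snu.
  have K_le := voronoi_dist_transport N0 UJ (ltW (s_gt0 l)) trT.
  have D_le : (D%:E <=
    \int[gaussian_mixture x (axis_cov m (s l))]_v (f v)%:E + (n.+1%:R^-1)%:E)%E.
    by near: l; exact: mean_approx.
  have K_gt : ((M1 * s l)%:E < \int[P]_v (norm1 (v - x (J v)))%:E)%E.
    by near: l.
  have f_le := C_ineq l T trT.
  have f_ge0 : (0 <= \int[gaussian_mixture x (axis_cov m (s l))]_v (f v)%:E)%E.
    by apply: integral_ge0 => v _; rewrite lee_fin norm1_ge0.
  move: Tcost K_le f_le; rewrite M1E.
  set dT := (\int[_]_(v in [set: 'rV[R]_m.+1]) (norm1 (v - T v))%:E)%E => Tcost K_le f_le.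
  have dT0 : (0 <= dT)%E by apply: integral_ge0 => v _; rewrite lee_fin norm1_ge0.
  have dT_le : (dT <= (eps + e + 3 * (M1 * s l))%:E)%E.
    by apply: (le_trans Tcost); rewrite [in leRHS]EFinD EFinM; apply: leeD.
  move: dT_le dT0 f_le K_le {Tcost}; case: dT => [r||//]; rewrite ?leye_eq//.
  rewrite !lee_fin => r_le r0 f_le /(lt_le_trans K_gt).
  rewrite -EFinD lte_fin ltrDr => r_gt0.
  have Cl0 : 0 <= C_ l.
    by have := le_trans f_ge0 f_le; rewrite -EFinM lee_fin pmulr_lge0.
  have := le_trans D_le (leeD f_le (lexx (n.+1%:R^-1)%:E)).
  rewrite -EFinM -EFinD lee_fin => /le_trans; apply.
  by rewrite lerD2r ler_wpM2l.
(* Here [l] tends to infinity with [e] and [n] fixed; the excess cost of the maps vanishes because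
   the first absolute moment is finite. *)
have bound (e : R) n : 0 < e -> D <= C * (eps + e) + n.+1%:R^-1.
  move=> e0; have /cvgr_to_ge : C_ l * (eps + e + 3 * (M1 * s l)) + n.+1%:R^-1
      @[l --> \oo] --> C * (eps + e + 3 * (M1 * 0)) + n.+1%:R^-1.
    apply: cvgD; last exact: cvg_cst.
    apply: cvgM => //; apply: cvgD; first exact: cvg_cst.
    by apply: cvgMl_tmp; apply: cvgMl_tmp; exact: s_cvg.
  by rewrite !mulr0 addr0; apply; exact: key.
apply/ler_addgt0Pr => r r0.
have r20 : 0 < r / 2 by rewrite divr_gt0.
(* Makes [C * e] at most [r / 2] whatever the sign of [C]; the term 1/(n+1) takes the other half. *)
have e0 : 0 < r / 2 / (`|C| + 1) by rewrite divr_gt0// ltr_wpDl.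
have [n _ /(_ n (leqnn n)) nr] := near_infty_natSinv_lt (PosNum r20).
apply: (le_trans (bound _ n e0)).
rewrite mulrDr -addrA lerD2l [leRHS]splitr lerD//; last exact: ltW.
apply: (@le_trans _ _ (`|C| * (r / 2 / (`|C| + 1)))).
  by rewrite ler_wpM2r ?ler_norm// ltW.
rewrite mulrA ler_pdivrMr ?ltr_wpDl// mulrC ler_wpM2l ?ltW//.
by rewrite ltrDl.
Unshelve. all: by end_near. Qed.

(** Replacing [x] by [h \o x] moves the empirical measure by at most the mean displacement:
    [C * eps] is added to the radius [eps]. *)
Lemma observed_wasserstein_le :
  (wasserstein P (empirical (h \o x)) <= ((C + 1) * eps)%:E)%E.
Proof.
apply: (le_trans (wasserstein_empirical_lip P x _)).
rewrite mulrDl mul1r addrC EFinD; apply: leeD => //.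
by rewrite lee_fin mean_dist_le.
Qed.

End observed_wasserstein.

Theorem theorem17 (R : realType) (c1 c2 : R -> nat -> R)
  (m : nat) (m_gt0 : (0 < m)%N) (a : R) (a_gt1 : 1 < a)
  (c1_gt0 : 0 < c1 a m) (c2_gt0 : 0 < c2 a m)
  (Xi : set 'rV[R]_m) (Xi_compact : compact Xi)
  (Pstar : probability 'rV[R]_m R)
  (Pstar_Xi : distributions_on Xi Pstar)
  (Pstar_ac : Pstar `<< lebesgue_rV m)
  (Pstar_light : light_tailed a Pstar)
  (N : nat) (N_gt0 : (0 < N)%N)
  (d : measure_display) (Omega : measurableType d) (Pr : probability Omega R)
  (xi : 'I_N -> {RV Pr >-> 'rV[R]_m}) (xi_iid : iid Pstar xi)
  (n : nat) (p : 'I_n -> nat) (pm : (\sum_(i < n) p i)%N = m)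
  (h_ : forall i, 'rV[R]_m -> 'rV[R]_(p i))
  (h_bij : bijective (stack pm h_))
  (h_meas : measurable_fun setT (stack pm h_))
  (C : R)
  (h_inferable : {ae Pr, forall omega,
     inferable Pstar (fun k => xi k omega) (stack pm h_) C})
  (theta : R) (theta_gt0 : 0 < theta) (theta_lt1 : theta < 1)
  (concentration :
     ((1 - theta)%:E <=
      Pr [set omega | wball Xi
            (concentration_radius a m N (c1 a m) (c2 a m) theta)
            (empirical (fun k => xi k omega)) Pstar])%E) :
  ((1 - theta)%:E <=
   Pr [set omega | wball Xi
         ((C + 1) * concentration_radius a m N (c1 a m) (c2 a m) theta)
         (empirical (fun k => stack pm h_ (xi k omega))) Pstar])%E.
Proof.
move: Xi Xi_compact Pstar Pstar_Xi Pstar_ac Pstar_light xi xi_iid pm h_ h_bij h_meas h_inferable concentration.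
case: m m_gt0 c1_gt0 c2_gt0 => // m' _ _ _ Xi _ P P_Xi P_ac _ xi [xi_law _] pm h_ _ mh h_inf.
set eps := concentration_radius _ _ _ _ _ _; set h := stack pm h_.
pose E1 := [set omega | (wasserstein P (empirical (xi ^~ omega)) <= eps%:E)%E].
pose E2 := [set omega |
  (wasserstein P (empirical (fun k => h (xi k omega))) <= ((C + 1) * eps)%:E)%E].
(* Membership of [P] in [distributions_on Xi] is given, so both events reduce to inequalities on the
   distance. *)
have ballE r (Q : set 'rV[R]_m'.+1 -> \bar R) : wball Xi r Q P = (wasserstein P Q <= r%:E)%E :> Prop.
  by apply/propext; split => [[]|].
rewrite (_ : [set omega | wball Xi eps _ P] = E1); last first.
  by apply/seteqP; split => omega; rewrite /= ballE.
rewrite (_ : [set omega | wball Xi _ _ P] = E2); last first.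
  by apply/seteqP; split => omega; rewrite /= ballE.
have mxi k : measurable_fun setT (xi k : Omega -> 'rV[R]_m'.+1) by [].
have mE1 : measurable E1 by exact: measurable_wasserstein_ball.
have mE2 : measurable E2.
  apply: (measurable_wasserstein_ball P _ (y := fun k => h \o xi k)) => k.
  exact: measurableT_comp.
pose f v := norm1 (v - h v).
have mf : measurable_fun setT f by apply: measurable_norm1; exact: measurable_rVB.
have f0 v : 0 <= f v by exact: norm1_ge0.
have approx : {ae Pr, forall omega, forall k, axis_approx f (xi k omega)}.
  (* The bad set is [P]-null and does not depend on the sample, and each of the finitely many sample
     points has law [P]. *)
  apply: filter_forall => k.
  have mbad : measurable [set v | ~ axis_approx f v].
    by apply: measurableC; exact: measurable_axis_approx.
  exists (xi k @^-1` [set v | ~ axis_approx f v]); split => //.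
  - by rewrite -[X in measurable X]setTI; exact: mxi.
  - have := xi_law k _ mbad; rewrite dominated_axis_approx//.
have [Z [mZ Z0 sZ]] : {ae Pr, forall omega, E1 omega -> E2 omega}.
  apply: filterS2 h_inf approx => omega hi ha; exact: observed_wasserstein_le.
move=> /le_trans; apply.
(* The implication between the events holds only off the null set [Z], which is added to [E2] and
   then discarded by subadditivity. *)
apply: (@le_trans _ _ (Pr (E2 `|` Z))).
  apply: le_measure; rewrite ?inE//; first exact: measurableU.
  move=> omega E1o; have [E2o|E2o] := pselect (E2 omega); [by left|right].
  by apply: sZ => /(_ E1o).
apply: (le_trans (measureU2 _ _ _)) => //.
by rewrite [X in (_ + X)%E]Z0 adde0.
Qed.
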